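(* Let $(\tilde q,\tilde p)$ be the solution on $[t_0,t_1]$ of the rough adjoint system with running costs $$q_t-q_{t_0}=\int_{t_0}^tf(q_r)\,dr+\sigma(q_r)\,d\mathbf{Z}_r,$$ $$p_{t_1}-p_t=-\int_t^{t_1}\left(\left[\Big(\frac{\partial f}{\partial q}(q_r)\Big)^*p_r+\frac{\partial L}{\partial q}(q_r)\right]dr+\left[\Big(\frac{\partial\sigma}{\partial q}(q_r)\Big)^*p_r+\frac{\partial\mathfrak{L}}{\partial q}(q_r)\right]d\mathbf{Z}_r\right),$$ and let $\delta\tilde q$ be the solution of the associated variational equation $$d\,\delta q_t=\frac{\partial f}{\partial q}(\tilde q_t)\,\delta q_t\,dt+\frac{\partial\sigma}{\partial q}(\tilde q_t)\,\delta q_t\,d\mathbf{Z}_t,\qquad\delta q_{t_0}=\delta a .$$ Then the following quasi-conservation law holds: $$\langle\tilde p_{t_1},\delta\tilde q_{t_1}\rangle-\langle\tilde p_{t_0},\delta\tilde q_{t_0}\rangle=-\int_{t_0}^{t_1}\left(\Big\langle\frac{\partial L}{\partial q}(\tilde q_r),\delta\tilde q_r\Big\rangle dr+\Big\langle\frac{\partial\mathfrak{L}}{\partial q}(\tilde q_r),\delta\tilde q_r\Big\rangle d\mathbf{Z}_r\right).$$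
   Context: Let $\alpha\in(\frac13,\frac12]$ and let $\mathbf{Z}=(Z,\mathbb{Z})$ be a fixed geometric $\alpha$-Hölder rough path on $[t_0,t_1]$ with values in $\mathbb{R}^K$ (Chen's relation and $\mathbb{Z}_{s,t}+\mathbb{Z}_{s,t}^*=Z_{s,t}\otimes Z_{s,t}$). Integrals against $\mathbf{Z}$ are rough integrals and solutions are paths controlled by $Z$ whose Gubinelli derivatives are the coefficients of $d\mathbf{Z}$. $f\in C^\infty(\mathbb{R}^N,\mathbb{R}^N)$, $\sigma\in C^\infty(\mathbb{R}^N,\mathcal{L}(\mathbb{R}^K,\mathbb{R}^N))$, $L\in C^\infty(\mathbb{R}^N,\mathbb{R})$, $\mathfrak{L}\in C^\infty(\mathbb{R}^N,\mathcal{L}(\mathbb{R}^K,\mathbb{R}))$; $\langle\cdot,\cdot\rangle$ is the Euclidean pairing on $\mathbb{R}^N$ (applied componentwise in the index of $\mathbf{Z}$ where relevant). $(\partial\sigma/\partial q)^*p\,d\mathbf{Z}$ has $i$-th component $\sum_{l,j}p_l\,\partial_{q_i}\sigma_{lj}(q)\,d\mathbf{Z}^j$, and $(\partial\sigma/\partial q)\delta q\,d\mathbf{Z}$ has $l$-th component $\sum_{i,j}\partial_{q_i}\sigma_{lj}(q)\,\delta q_i\,d\mathbf{Z}^j$. (The system is the rough Hamiltonian system for $H=\langle p,f(q)\rangle+L(q)$, $\mathcal{H}=\langle p,\sigma(q)\rangle+\mathfrak{L}(q)$.) $\delta a\in\mathbb{R}^N$. *)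

(* Defs.v *)
From HB Require Import structures.
From mathcomp Require Import all_boot all_order all_algebra.
From mathcomp Require Import all_classical all_reals all_analysis.

Set Implicit Arguments.
Unset Strict Implicit.
Unset Printing Implicit Defensive.

Import Order.TTheory GRing.Theory Num.Theory.
Import numFieldNormedType.Exports.

Local Open Scope classical_set_scope.
Local Open Scope ring_scope.

(* Vectors of R^n are columns, and L(R^K, R^m) is 'M[R]_(m, K).
   Paths are total functions on R, constrained on [t0, t1] only. *)

(* Infinitely Frechet differentiable: since every iterated directional
   derivative is itself differentiable, all of them are continuous, so on
   R^n this is the usual C^oo. *)
Definition smooth (R : realType) (n : nat) (W : normedModType R)
    (F : 'cV[R]_n -> W) : Prop :=
  forall (vs : seq 'cV[R]_n) (x : 'cV[R]_n),
    differentiable (foldr (fun v G => 'D_v G) F vs) x.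

Definition partial (R : realType) (n : nat) (W : normedModType R)
    (i : 'I_n) (F : 'cV[R]_n -> W) (x : 'cV[R]_n) : W :=
  'D_(delta_mx i 0 : 'cV[R]_n) F x.

Definition gradient (R : realType) (n : nat) (F : 'cV[R]_n -> R)
    (x : 'cV[R]_n) : 'cV[R]_n :=
  \col_i partial i F x.

(* The library's 'J acts on row vectors. *)
Definition jac (R : realType) (n m : nat) (F : 'cV[R]_n -> 'cV[R]_m)
    (x : 'cV[R]_n) : 'M[R]_(m, n) :=
  \matrix_(l, i) (partial i F x) l 0.

Definition dotp (R : realType) (n : nat) (x y : 'cV[R]_n) : R :=
  \sum_i x i 0 * y i 0.

(* The second level is meaningful on the simplex s <= t, with
   rp2 s t i j = \int_s^t (Z^i_r - Z^i_s) dZ^j_r. *)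
Record rough_path (R : realType) (K : nat) := RoughPath {
  rp1 : R -> 'cV[R]_K ;
  rp2 : R -> R -> 'M[R]_K }.

Definition rp_incr (R : realType) (K : nat) (Z : rough_path R K) (s t : R) :
    'cV[R]_K :=
  rp1 Z t - rp1 Z s.

Definition holder2 (R : realType) (V : normedModType R) (a t0 t1 : R)
    (X : R -> R -> V) : Prop :=
  exists C : R, forall s t : R, t0 <= s -> s <= t -> t <= t1 ->
    `|X s t| <= C * (t - s) `^ a.

Definition holder (R : realType) (V : normedModType R) (a t0 t1 : R)
    (Y : R -> V) : Prop :=
  holder2 a t0 t1 (fun s t => Y t - Y s).

Definition geometric_rough_path (R : realType) (K : nat) (alpha t0 t1 : R)
    (Z : rough_path R K) : Prop :=
  [/\ holder alpha t0 t1 (rp1 Z),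
      holder2 (2 * alpha) t0 t1 (rp2 Z),
      forall s u t : R, t0 <= s -> s <= u -> u <= t -> t <= t1 ->
        rp2 Z s t = rp2 Z s u + rp2 Z u t + rp_incr Z s u *m (rp_incr Z u t)^T &
      forall s t : R, t0 <= s -> s <= t -> t <= t1 ->
        rp2 Z s t + (rp2 Z s t)^T = rp_incr Z s t *m (rp_incr Z s t)^T].

(* A Gubinelli derivative Y' : R -> L(R^K, V) is given by its values
   Y' r i in the coordinate directions. *)
Definition controlled (R : realType) (K : nat) (V : normedModType R)
    (alpha t0 t1 : R) (Z : rough_path R K)
    (Y : R -> V) (Y' : R -> 'I_K -> V) : Prop :=
  [/\ holder alpha t0 t1 Y,
      forall i, holder alpha t0 t1 (Y' ^~ i) &
      holder2 (2 * alpha) t0 t1 (fun s t =>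
        Y t - Y s - \sum_i (rp_incr Z s t) i 0 *: Y' s i)].

(* A partition s = u_0 < ... < u_k = t is the list [:: u_1; ...; u_k]. *)
Definition mesh_filter (R : realType) (s t : R) : set_system (seq R) :=
  filter_from [set d : R | 0 < d] (fun d =>
    [set pi : seq R | itv_partition s t pi /\ path (fun u v => v - u < d) s pi]).

(* Here C is a path in L(R^K, R^m) with Gubinelli derivative C'; the l-th
   entry of the summand over [u, v] is
   \sum_j C u l j * Z^j_{u,v} + \sum_(i, j) C' u i l j * ZZ^{ij}_{u,v}. *)
Definition rough_sum (R : realType) (K m : nat) (Z : rough_path R K)
    (C : R -> 'M[R]_(m, K)) (C' : R -> 'I_K -> 'M[R]_(m, K))
    (s : R) (pi : seq R) : 'cV[R]_m :=
  \sum_(uv <- zip (s :: pi) pi)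
    (C uv.1 *m rp_incr Z uv.1 uv.2
     + \sum_i C' uv.1 i *m (row i (rp2 Z uv.1 uv.2))^T).

Definition rough_int (R : realType) (K m : nat) (Z : rough_path R K)
    (C : R -> 'M[R]_(m, K)) (C' : R -> 'I_K -> 'M[R]_(m, K)) (s t : R) :
    'cV[R]_m :=
  lim (rough_sum Z C C' s @ mesh_filter s t).

Definition rough_integrable (R : realType) (K m : nat) (alpha s t : R)
    (Z : rough_path R K)
    (C : R -> 'M[R]_(m, K)) (C' : R -> 'I_K -> 'M[R]_(m, K)) : Prop :=
  controlled alpha s t Z C C' /\ cvg (rough_sum Z C C' s @ mesh_filter s t).

Definition drift_int (R : realType) (m : nat) (b : R -> 'cV[R]_m) (s t : R) :
    'cV[R]_m :=
  \col_l \int[lebesgue_measure]_(r in `[s, t]) b r l 0.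

(* Gubinelli derivative DG(Y) Y' of G(Y), for (Y, Y') controlled. *)
Definition comp_gub (R : realType) (K : nat) (V W : normedModType R)
    (G : V -> W) (Y : R -> V) (Y' : R -> 'I_K -> V) (r : R) (i : 'I_K) : W :=
  'D_(Y' r i) G (Y r).

Section coefficients.
Context (R : realType) (N K : nat).
Context (f : 'cV[R]_N -> 'cV[R]_N) (sigma : 'cV[R]_N -> 'M[R]_(N, K)).
Context (L : 'cV[R]_N -> R) (LL : 'cV[R]_N -> 'rV[R]_K).

Definition costate_drift (q p : 'cV[R]_N) : 'cV[R]_N :=
  (jac f q)^T *m p + gradient L q.

Definition costate_diffusion (q p : 'cV[R]_N) : 'M[R]_(N, K) :=
  \matrix_(i, j) (\sum_l p l 0 * (partial i sigma q) l j
                  + (partial i LL q) 0 j).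

Definition variation_drift (q dq : 'cV[R]_N) : 'cV[R]_N := jac f q *m dq.

Definition variation_diffusion (q dq : 'cV[R]_N) : 'M[R]_(N, K) :=
  \matrix_(l, j) \sum_i (partial i sigma q) l j * dq i 0.

Definition running_cost_pairing (q dq : 'cV[R]_N) : 'rV[R]_K :=
  \row_j dotp (\col_i (partial i LL q) 0 j) dq.

End coefficients.

Section solutions.
Context (R : realType) (N K : nat).
Context (alpha t0 t1 : R) (Z : rough_path R K).
Context (f : 'cV[R]_N -> 'cV[R]_N) (sigma : 'cV[R]_N -> 'M[R]_(N, K)).
Context (L : 'cV[R]_N -> R) (LL : 'cV[R]_N -> 'rV[R]_K).

(* The Gubinelli derivative of a solution is its coefficient of dZ; for p this
   carries the minus sign of the backward equation. *)
Definition q_gub (q : R -> 'cV[R]_N) (r : R) (j : 'I_K) : 'cV[R]_N :=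
  col j (sigma (q r)).

Definition p_gub (q p : R -> 'cV[R]_N) (r : R) (j : 'I_K) : 'cV[R]_N :=
  - col j (costate_diffusion sigma LL (q r) (p r)).

Definition dq_gub (q dq : R -> 'cV[R]_N) (r : R) (j : 'I_K) : 'cV[R]_N :=
  col j (variation_diffusion sigma (q r) (dq r)).

Definition pair_path (V W : normedModType R) (x : R -> V) (y : R -> W) (r : R) :
    (V * W)%type :=
  (x r, y r).

Definition pair_gub (V W : normedModType R) (x' : R -> 'I_K -> V)
    (y' : R -> 'I_K -> W) (r : R) (j : 'I_K) : (V * W)%type :=
  (x' r j, y' r j).

Definition adjoint_solution (q p : R -> 'cV[R]_N) : Prop :=
  [/\ controlled alpha t0 t1 Z q (q_gub q),
      controlled alpha t0 t1 Z p (p_gub q p),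
      forall t : R, t0 <= t <= t1 ->
        q t - q t0 =
          drift_int (fun r => f (q r)) t0 t
          + rough_int Z (fun r => sigma (q r))
              (comp_gub sigma q (q_gub q)) t0 t &
      forall t : R, t0 <= t <= t1 ->
        p t1 - p t =
          - (drift_int (fun r => costate_drift f L (q r) (p r)) t t1
             + rough_int Z (fun r => costate_diffusion sigma LL (q r) (p r))
                 (comp_gub (fun x => costate_diffusion sigma LL x.1 x.2)
                    (pair_path q p) (pair_gub (q_gub q) (p_gub q p))) t t1)].

Definition variational_solution (q : R -> 'cV[R]_N) (da : 'cV[R]_N)
    (dq : R -> 'cV[R]_N) : Prop :=
  [/\ controlled alpha t0 t1 Z dq (dq_gub q dq),
      dq t0 = da &
      forall t : R, t0 <= t <= t1 ->
        dq t - dq t0 =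
          drift_int (fun r => variation_drift f (q r) (dq r)) t0 t
          + rough_int Z (fun r => variation_diffusion sigma (q r) (dq r))
              (comp_gub (fun x => variation_diffusion sigma x.1 x.2)
                 (pair_path q dq) (pair_gub (q_gub q) (dq_gub q dq))) t0 t].

Definition pairing_gub (q dq : R -> 'cV[R]_N) : R -> 'I_K -> 'rV[R]_K :=
  comp_gub (fun x => running_cost_pairing LL x.1 x.2)
    (pair_path q dq) (pair_gub (q_gub q) (dq_gub q dq)).

End solutions.

(* Main.v *)
Require Import Defs.
From HB Require Import structures.
From mathcomp Require Import all_boot all_order all_algebra.
From mathcomp Require Import all_classical all_reals all_analysis.
From mathcomp Require Import ring lra.

Set Implicit Arguments.
Unset Strict Implicit.
Unset Printing Implicit Defensive.

Import Order.TTheory GRing.Theory Num.Theory.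
Import numFieldNormedType.Exports.

Local Open Scope classical_set_scope.
Local Open Scope ring_scope.

(** In the smooth case the product rule is applied to the pairing of [p] with
    [dq]: since the costate equation is the adjoint of the variational one, the
    terms in [f] and [sigma] cancel and only the running costs are left. Here the
    same cancellation takes place in local expansions.

    Over a short interval [[s, t]] the integral of [b dr + C dZ] is, up to an
    error of order [3 * alpha > 1] in [t - s], equal to its germ
    [b s * (t - s) + C s * Z_{s,t} + C' s * ZZ_{s,t}] ([solution_expansion]).
    The increment of the pairing is then, up to such an error, the sum of the
    germ of [dq] paired with [p s], of the germ of [p] paired with [dq s], and of
    the product of the two increments ([dotp_increment]). That product reduces to
    the product of the first-level terms ([controlled_increment_product]), which
    geometricity turns into a second-level term ([first_level_product]). In the
    total, the time and first-level terms cancel because of adjointness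
    ([duality_drift]), the second-level terms because they are the derivative of
    this first-level identity along the Gubinelli derivatives
    ([duality_second_level]), and minus the germ of the running costs remains
    ([pairing_increment]).

    Consequently minus the sum of the pairing and of the time integral of the
    running cost [L] has the germ of the rough running cost as its expansion.
    As errors of order above 1 disappear when they are summed over fine
    partitions, the Riemann sums of the running cost converge to the increment
    of that path ([rough_sum_cvg]): this gives both the existence of the rough
    integral and its value.

    The expansions of the solutions come from the sewing lemma ([sewing]). Its
    hypothesis for a rough integral follows from Chen's relation
    ([rough_germ_almost_additive]), as soon as the coefficient is a controlled
    path; for the coefficients of the system this is the chain and product rule
    ([controlled_smooth], [controlledM], [controlled_affine_mx]). *)

(** * Sums over partitions *)

Definition partition_sum (R : realType) (X : R -> R -> R) (s : R)
    (pi : seq R) : R :=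
  \sum_(uv <- zip (s :: pi) pi) X uv.1 uv.2.

Definition finer (R : realType) (d s : R) (pi : seq R) : bool :=
  path (fun u v => v - u < d) s pi.

Section partition_sum.
Context {R : realType}.
Implicit Types (X : R -> R -> R) (s t : R) (pi : seq R).

Lemma partition_sum_nil X s : partition_sum X s [::] = 0.
Proof. by rewrite /partition_sum /= big_nil. Qed.

Lemma partition_sum_cons X s u pi :
  partition_sum X s (u :: pi) = X s u + partition_sum X u pi.
Proof. by rewrite /partition_sum /= big_cons. Qed.

Lemma partition_sum_cat X s pi pi' :
  partition_sum X s (pi ++ pi') =
  partition_sum X s pi + partition_sum X (last s pi) pi'.
Proof.
elim: pi s => [|u pi IH] s /=; first by rewrite partition_sum_nil add0r.
by rewrite !partition_sum_cons IH addrA.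
Qed.

Lemma itv_partition_cat_inv (s t : R) pi pi' :
  itv_partition s t (pi ++ pi') ->
  itv_partition s (last s pi) pi /\ itv_partition (last s pi) t pi'.
Proof.
by rewrite /itv_partition cat_path last_cat => -[/andP[-> ->] ->]; split.
Qed.

Lemma itv_partition_mem (s t x : R) pi :
  itv_partition s t pi -> x \in pi -> s < x <= t.
Proof.
move=> pp /splitPr xpi; case: xpi pp => l1 l2; rewrite -cat_rcons => pp.
have [+ /itv_partition_le] := itv_partition_cat_inv pp.
by rewrite last_rcons => /itv_partition_size_neq0 ->; rewrite ?size_rcons.
Qed.

Lemma exists_finer d s t : 0 < d -> s <= t ->
  exists pi, itv_partition s t pi /\ finer d s pi.
Proof.
move=> d0 st.
have [n] : exists n : nat, t - s < n%:R * (d / 2).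
  exists (Num.bound ((t - s) / (d / 2))).
  rewrite -ltr_pdivrMr ?divr_gt0//; apply: archi_boundP.
  by rewrite divr_ge0 ?divr_ge0 ?subr_ge0 ?(ltW d0).
elim: n s st => [|n IH] s st h; first by move: h; rewrite mul0r; lra.
case: (eqVneq s t) => [->|sNt]; first by exists [::].
have {}st : s < t by rewrite lt_neqAle sNt.
have [tsd|dts] := ltP (t - s) d.
  by exists [:: t]; rewrite /finer /= tsd; split => //; exact: itv_partition1.
have [||pi [[pp pl] fp]] := IH (s + d / 2); first by lra.
  by move: h; rewrite -[n.+1%:R]natr1 mulrDl; lra.
exists (s + d / 2 :: pi); rewrite /finer /=; split; first split => //=.
  by rewrite pp andbT; lra.
by rewrite [path _ _ _]fp andbT; lra.
Qed.

#[export] Instance mesh_filter_filter s t : Filter (mesh_filter s t).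
Proof.
apply: filter_from_filter; first by exists 1; rewrite /= ltr01.
move=> d d' d0 d'0; exists (Num.min d d'); first by rewrite /= lt_min; apply/andP.
move=> pi [pp fp]; split; split => //; apply: sub_path fp => u v;
  by rewrite lt_min => /andP[].
Qed.

Lemma mesh_filter_proper s t : s <= t -> ProperFilter (mesh_filter s t).
Proof.
move=> st; apply: filter_from_proper => d d0.
by have [pi ppi] := exists_finer d0 st; exists pi.
Qed.

Lemma partition_sum_cvgP X s t l :
  partition_sum X s @ mesh_filter s t --> l <->
  forall e, 0 < e -> exists2 d, 0 < d & forall pi, itv_partition s t pi ->
    finer d s pi -> `|l - partition_sum X s pi| < e.
Proof.
split=> [/cvgrPdist_lt h e e0|h].
  by have [d d0 hd] := h e e0; exists d => // pi ppi fpi; exact: hd.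
apply/cvgrPdist_lt => e e0; have [d d0 hd] := h e e0.
by exists d => // pi [ppi fpi]; exact: hd.
Qed.

(** Each interval of a partition finer than [d] contributes at most
    [d ^ (theta - 1)] times its length; this is why terms of order [theta > 1]
    disappear in the limit. *)
Lemma partition_sum_powR d theta s t pi : 1 < theta ->
  itv_partition s t pi -> finer d s pi ->
  partition_sum (fun u v => (v - u) `^ theta) s pi
    <= d `^ (theta - 1) * (t - s).
Proof.
move=> th1; elim: pi s => [|u pi IH] s.
  by move=> /itv_partition_nil ->; rewrite partition_sum_nil subrr mulr0.
move=> pp; rewrite /finer /= => /andP[usd fp].
have su : s < u by case: pp => /= /andP[].
rewrite partition_sum_cons.
have -> : t - s = (u - s) + (t - u) by ring.
rewrite mulrDr lerD//; last by apply: IH => //; exact: itv_partition_cons pp.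
rewrite -mulr_powRB1 ?subr_ge0 ?(ltW su)//; last by lra.
rewrite mulrC ler_wpM2r ?subr_ge0 ?(ltW su)//.
by apply: ge0_ler_powR; rewrite ?nnegrE; lra.
Qed.

Lemma ler_partition_sum (X Y : R -> R -> R) s t pi : itv_partition s t pi ->
  (forall u v, s <= u -> u <= v -> v <= t -> `|X u v| <= Y u v) ->
  `|partition_sum X s pi| <= partition_sum Y s pi.
Proof.
elim: pi s => [|u pi IH] s pp XY; first by rewrite !partition_sum_nil normr0.
have su : s < u by case: pp => /= /andP[].
have ut : u <= t by apply: itv_partition_le (itv_partition_cons pp).
rewrite !partition_sum_cons (le_trans (ler_normD _ _))// lerD//.
  by apply: XY => //; exact: ltW.
apply: IH => [|v w uv]; first exact: itv_partition_cons pp.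
by apply: XY; apply: le_trans uv; exact: ltW.
Qed.

Lemma partition_sumZ k X s pi :
  partition_sum (fun u v => k * X u v) s pi = k * partition_sum X s pi.
Proof. by rewrite /partition_sum mulr_sumr. Qed.

Lemma partition_sumB X Y s pi :
  partition_sum (fun u v => X u v - Y u v) s pi =
  partition_sum X s pi - partition_sum Y s pi.
Proof. by rewrite /partition_sum sumrB. Qed.

Lemma partition_sum_telescope (h : R -> R) s t pi : itv_partition s t pi ->
  partition_sum (fun u v => h v - h u) s pi = h t - h s.
Proof.
elim: pi s => [|u pi IH] s pp.
  by rewrite partition_sum_nil (itv_partition_nil pp) subrr.
by rewrite partition_sum_cons (IH _ (itv_partition_cons pp)); ring.
Qed.

End partition_sum.

Section holder2_constant.
Context {R : realType} {V : normedModType R}.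

Lemma holder2_pos a t0 t1 (X : R -> R -> V) : holder2 a t0 t1 X ->
  exists2 C, 0 <= C & forall s t, t0 <= s -> s <= t -> t <= t1 ->
    `|X s t| <= C * (t - s) `^ a.
Proof.
move=> [C hC]; exists (Num.max 0 C); first by rewrite le_max lexx.
move=> s t ? ? ?; apply: le_trans (hC s t _ _ _) _ => //.
by rewrite ler_wpM2r ?powR_ge0// le_max lexx orbT.
Qed.

End holder2_constant.

(** * The sewing lemma *)

(** Order of an error that involves an intermediate point, such as the defect
    [X s t - X s u - X u t] of additivity. *)
Definition holder3 (R : realType) (a t0 t1 : R) (X : R -> R -> R -> R) : Prop :=
  exists C : R, forall s u t : R, t0 <= s -> s <= u -> u <= t -> t <= t1 ->
    `|X s u t| <= C * (t - s) `^ a.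

(** The fixed point of the recursion in [partition_sum_near]. *)
Definition sewing_constant (R : realType) (theta C : R) : R :=
  2 * C / (1 - 2 `^ (1 - theta)).

Section sewing.
Context {R : realType} (theta t0 t1 : R) (X : R -> R -> R).
Hypothesis theta1 : 1 < theta.

Let theta_ge0 : 0 <= theta. Proof. exact: ltW (lt_trans ltr01 theta1). Qed.

(** Uniqueness: a path whose increments agree with [X] up to order
    [theta > 1] is the limit of the sums of [X]. *)
Lemma partition_sum_cvg (h : R -> R) :
  holder2 theta t0 t1 (fun s t => h t - h s - X s t) ->
  forall s t, t0 <= s -> s <= t -> t <= t1 ->
  partition_sum X s @ mesh_filter s t --> h t - h s.
Proof.
move=> /holder2_pos[C C0 hC] s t t0s st tt1; apply/partition_sum_cvgP => e e0.
have B0 : 0 < C * (t - s) + 1.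
  by rewrite ltr_wpDl ?mulr_ge0 ?subr_ge0.
exists ((e / (C * (t - s) + 1)) `^ (theta - 1)^-1).
  by rewrite powR_gt0// divr_gt0.
move=> pi pp fp.
rewrite -(partition_sum_telescope h pp) -partition_sumB.
apply: (@le_lt_trans _ _
  (partition_sum (fun u v => C * (v - u) `^ theta) s pi)).
  apply: ler_partition_sum (pp) _ => u v su uv vt; apply: hC => //.
    exact: le_trans su.
  exact: le_trans tt1.
rewrite partition_sumZ.
apply: le_lt_trans (ler_wpM2l C0 (partition_sum_powR theta1 pp fp)) _.
rewrite -powRrM mulVf ?subr_eq0 ?gt_eqF// powRr1 ?divr_ge0 ?(ltW e0) ?(ltW B0)//.
rewrite mulrCA mulrAC ltr_pdivrMr// ltr_pM2l//; lra.
Qed.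

Variable C : R.
Hypothesis C0 : 0 <= C.
Hypothesis almost_additive : forall s u t, t0 <= s -> s <= u -> u <= t -> t <= t1 ->
  `|X s t - X s u - X u t| <= C * (t - s) `^ theta.

Local Notation M := (sewing_constant theta C).

Let ratio_lt1 : 2 `^ (1 - theta) < 1.
Proof.
have := @powRN R 2 (theta - 1); rewrite opprB => ->.
rewrite invf_lt1 ?powR_gt0//.
rewrite -[ltLHS](_ : 1 `^ (theta - 1) = 1); last by rewrite powR1.
by apply: gt0_ltr_powR; rewrite ?nnegrE ?subr_gt0// ltr1n.
Qed.

Let M0 : 0 <= M.
Proof. by rewrite /sewing_constant divr_ge0 ?mulr_ge0// subr_ge0 ltW. Qed.

(** The bound does not depend on the number of points. Remove from the
    partition the interval that contains the midpoint of [[s, t]]: the two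
    remaining pieces have at most half the length, and they contribute
    [2 * M * ((t - s) / 2) ^ theta] by induction, whereas joining the three
    pieces costs [2 * C * (t - s) ^ theta]. Hence the bound holds as soon as
    [M = M * 2 ^ (1 - theta) + 2 * C], which has a solution because
    [theta > 1]. *)
Lemma partition_sum_near s t pi : t0 <= s -> t <= t1 -> itv_partition s t pi ->
  `|partition_sum X s pi - X s t| <= M * (t - s) `^ theta.
Proof.
have [n] := ubnP (size pi); elim: n => // n IH in s t pi *.
rewrite ltnS => szpi t0s tt1 pp.
have st := itv_partition_le pp.
have [seqt|sNt] := eqVneq s t.
  subst t; rewrite (itv_partitionxx pp) partition_sum_nil.
  have := almost_additive t0s (lexx s) (lexx s) tt1.
  rewrite [s - s]subrr powR0 ?gt_eqF ?(lt_trans _ theta1)//.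
  by rewrite subrr !mulr0.
have {sNt}st' : s < t by rewrite lt_neqAle sNt.
pose m := (s + t) / 2.
have hm : has (fun u => m < u) pi.
  apply/hasP; exists t; last by rewrite /m; lra.
  case: (pi) pp => [/itv_partition_nil E|x l [_ /eqP <-]]; last first.
    by rewrite /= mem_last.
  by rewrite E ltxx in st'.
have := hm; move: szpi pp.
case/split_find: hm => u pi1 pi2 mu pi1m szpi pp _.
pose v := last s pi1.
move: pp; rewrite -cats1 -catA /= => pp.
have [pp1 /[dup] pp2 /itv_partition_cons pp3] := itv_partition_cat_inv pp.
rewrite -/v in pp1 pp2.
have vu : v < u by case: pp2 => /= /andP[].
have sv := itv_partition_le pp1; have ut := itv_partition_le pp3.
have vm : v <= m.
  rewrite leNgt /v; apply/negP => mv; move/negP: pi1m; apply.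
  apply/hasP; exists (last s pi1) => //.
  move: mv; case: (pi1) => [/=|x l _]; last by rewrite /= mem_last.
  by rewrite /m; lra.
have sz1 : (size pi1 < n)%N.
  by apply: leq_trans szpi; rewrite size_cat size_rcons leq_addr.
have sz2 : (size pi2 < n)%N.
  by apply: leq_trans szpi; rewrite size_cat size_rcons addSn ltnS leq_addl.
have vt1 : v <= t1 by lra.
have h1 := IH _ _ _ sz1 t0s vt1 pp1.
have t0u : t0 <= u by lra.
have h2 := IH _ _ _ sz2 t0u tt1 pp3.
have su : s <= u by lra.
have ut1 : u <= t1 by lra.
have h3 := almost_additive t0s su ut tt1.
have h4 := almost_additive t0s sv (ltW vu) ut1.
have half x : 0 <= x -> x <= (t - s) / 2 ->
    x `^ theta <= (2 `^ theta)^-1 * (t - s) `^ theta.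
  move=> x0 xl; have -> : (2 `^ theta)^-1 * (t - s) `^ theta = ((t - s) / 2) `^ theta.
    rewrite powRM ?invr_ge0 ?subr_ge0//.
    by rewrite -(powR_inv1 (ler0n R 2)) powRAC powR_inv1 ?powR_ge0// mulrC.
  by apply: ge0_ler_powR; rewrite ?nnegrE ?theta_ge0//; lra.
have b1 : (v - s) `^ theta <= (2 `^ theta)^-1 * (t - s) `^ theta.
  by apply: half; rewrite /m in vm mu; lra.
have b2 : (t - u) `^ theta <= (2 `^ theta)^-1 * (t - s) `^ theta.
  by apply: half; rewrite /m in vm mu; lra.
have b3 : (u - s) `^ theta <= (t - s) `^ theta.
  by apply: ge0_ler_powR; rewrite ?nnegrE ?theta_ge0//; lra.
set T := (t - s) `^ theta in h3 b1 b2 b3 *.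
rewrite partition_sum_cat partition_sum_cons -/v.
have ME : M = M * (2 * (2 `^ theta)^-1) + 2 * C.
  have -> : 2 * (2 `^ theta)^-1 = 2 `^ (1 - theta) :> R.
    by rewrite powRB ?powRr1// eq_sym gt_eqF.
  by rewrite /sewing_constant; field; rewrite gt_eqF// subr_gt0.
have {}b1 := ler_wpM2l M0 b1; have {}b2 := ler_wpM2l M0 b2.
have {}b3 := ler_wpM2l C0 b3.
set S1 := partition_sum X s pi1 in h1 *.
set S2 := partition_sum X u pi2 in h2 *.
have -> : S1 + (X v u + S2) - X s t = (S1 - X s v) + (S2 - X u t)
   - (X s u - X s v - X v u) - (X s t - X s u - X u t) by ring.
apply: le_trans (ler_normB _ _) _.
apply: le_trans (lerD (ler_normB _ _) (lexx _)) _.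
apply: le_trans (lerD (lerD (ler_normD _ _) (lexx _)) (lexx _)) _.
rewrite [leRHS](_ : _ = M * ((2 `^ theta)^-1 * T) + M * ((2 `^ theta)^-1 * T)
   + C * T + C * T); last by rewrite {1}ME; ring.
lra.
Qed.

(** A refinement of [pi] restricts to a partition of each interval of [pi], to
    which [partition_sum_near] applies. *)
Lemma refinement_sum_near s t pi rho : t0 <= s -> t <= t1 ->
  itv_partition s t pi -> itv_partition s t rho -> {subset pi <= rho} ->
  `|partition_sum X s rho - partition_sum X s pi| <=
    partition_sum (fun u v => M * (v - u) `^ theta) s pi.
Proof.
move=> + tt1; elim: pi s rho => [|u pi IH] s rho t0s pp.
  rewrite (itv_partition_nil pp) => /itv_partitionxx -> _.
  by rewrite !partition_sum_nil subrr normr0.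
move=> pr sub; have urho : u \in rho by apply: sub; rewrite mem_head.
case/splitPr: urho pr sub => r1 r2; rewrite -cat_rcons => pr sub.
have [] := itv_partition_cat_inv pr; rewrite last_rcons => pr1 pr2.
have su : s <= u := itv_partition_le pr1.
have pp' := itv_partition_cons pp.
have ut := itv_partition_le pp'.
have t0u : t0 <= u by lra.
have ut1 : u <= t1 by lra.
have sub' : {subset pi <= r2}.
  move=> x xpi; have ux : u < x.
    case: pp => /= /andP[_ /lt_path_min/allP + _].
    exact.
  have : x \in rcons r1 u ++ r2 by apply: sub; rewrite inE xpi orbT.
  rewrite mem_cat => /orP[xr1|//].
  by have /andP[_] := itv_partition_mem pr1 xr1; rewrite leNgt ux.
have h1 := partition_sum_near t0s ut1 pr1.
have h2 := IH _ _ t0u pp' pr2 sub'.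
rewrite partition_sum_cat last_rcons !partition_sum_cons.
set a := partition_sum X s _ in h1 *; set b := partition_sum X u r2 in h2 *.
set c := partition_sum X u pi in h2 *.
rewrite [X in `|X|](_ : _ = (a - X s u) + (b - c)); last by ring.
exact: le_trans (ler_normD _ _) (lerD h1 h2).
Qed.

Lemma common_refinement s t (pi pi' : seq R) :
  itv_partition s t pi -> itv_partition s t pi' ->
  exists rho, [/\ itv_partition s t rho, {subset pi <= rho} & {subset pi' <= rho}].
Proof.
move=> pp pp'.
case: pi pp => [|u pi] pp.
  by exists [::]; split => // x; rewrite (itv_partition_nil pp) in pp' *;
     rewrite (itv_partitionxx pp').
set l := u :: pi in pp *.
pose rho := sort <=%R (undup (l ++ pi')).
have mrho x : (x \in rho) = (x \in l) || (x \in pi').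
  by rewrite mem_sort mem_undup mem_cat.
have brho x : x \in rho -> s < x <= t.
  by rewrite mrho => /orP[]; exact: itv_partition_mem.
have trho : t \in rho.
  by rewrite mrho; case: pp => _ /eqP <-; rewrite /= mem_last.
have srho : path <%R s rho.
  rewrite path_sortedE; last exact: lt_trans.
  apply/andP; split; first by apply/allP => x /brho/andP[].
  by rewrite sort_lt_sorted undup_uniq.
exists rho; split; last 2 first.
- by move=> x xl; rewrite mrho xl.
- by move=> x xl; rewrite mrho xl orbT.
split => //; case/splitPr: trho brho srho => r1 r2 brho.
rewrite cat_path last_cat /= => /and3P[_ _].
case: r2 brho => [//|y r2] brho /= /andP[ty _].
have /andP[_ yt] : s < y <= t by apply: brho; rewrite mem_cat !inE eqxx !orbT.
by move: ty; rewrite ltNge yt.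
Qed.

(** Any two fine partitions are compared through a common refinement. *)
Lemma partition_sum_is_cvg s t : t0 <= s -> s <= t -> t <= t1 ->
  cvg (partition_sum X s @ mesh_filter s t).
Proof.
move=> t0s st tt1; have := mesh_filter_proper st => ?.
apply: cauchy_cvg; apply: cauchy_exP => e e0.
have B0 : 0 < 2 * M * (t - s) + 1.
  have D0 : 0 <= t - s by rewrite subr_ge0.
  by have := mulr_ge0 (mulr_ge0 (ler0n R 2) M0) D0; lra.
pose d := (e / (2 * M * (t - s) + 1)) `^ (theta - 1)^-1.
have d0 : 0 < d by rewrite powR_gt0// divr_gt0.
have dE : 2 * (M * (d `^ (theta - 1) * (t - s))) < e.
  rewrite /d -powRrM mulVf ?subr_eq0 ?gt_eqF// powRr1 ?divr_ge0 ?(ltW e0) ?(ltW B0)//.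
  rewrite [ltLHS](_ : _ = e * (2 * M * (t - s)) / (2 * M * (t - s) + 1)); last first.
    by field; rewrite gt_eqF.
  by rewrite ltr_pdivrMr// ltr_pM2l//; lra.
have [pi [pp fp]] := exists_finer d0 st.
exists (partition_sum X s pi); exists d => // pi' [pp' fp'] /=.
rewrite /ball /=.
have [rho [pr sub sub']] := common_refinement pp pp'.
have h := refinement_sum_near t0s tt1 pp pr sub.
have h' := refinement_sum_near t0s tt1 pp' pr sub'.
rewrite !partition_sumZ in h h'.
have k := ler_wpM2l M0 (partition_sum_powR theta1 pp fp).
have k' := ler_wpM2l M0 (partition_sum_powR theta1 pp' fp').
rewrite distrC in h.
apply: le_lt_trans dE.
apply: le_trans (ler_distD (partition_sum X s rho) _ _) _.
lra.
Qed.

Lemma sewing_bound : exists h : R -> R,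
  holder2 theta t0 t1 (fun s t => h t - h s - X s t).
Proof.
exists (fun t => lim (partition_sum X t0 @ mesh_filter t0 t)).
exists M => s t t0s st tt1; apply/ler_addgt0Pr => e e0.
have t0t := le_trans t0s st; have st1 := le_trans st tt1.
have /partition_sum_cvgP cs := @partition_sum_is_cvg t0 s (lexx _) t0s st1.
have /partition_sum_cvgP ct := @partition_sum_is_cvg t0 t (lexx _) t0t tt1.
set hs := lim _ in cs *; set ht := lim _ in ct *.
have e20 : 0 < e / 2 by lra.
have [d d0 hd] := cs _ e20; have [d' d'0 hd'] := ct _ e20.
pose c := Num.min d d'; have c0 : 0 < c by rewrite lt_min d0.
have [pi [pp fp]] := exists_finer c0 t0s.
have [pi' [pp' fp']] := exists_finer c0 st.
have lpi : last t0 pi = s by case: pp => _ /eqP.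
have k1 : `|hs - partition_sum X t0 pi| < e / 2.
  by apply: hd => //; apply: sub_path fp => u v; rewrite lt_min => /andP[].
have k2 : `|ht - partition_sum X t0 (pi ++ pi')| < e / 2.
  apply: hd'; first exact: itv_partition_cat pp pp'.
  rewrite /finer cat_path lpi; apply/andP.
  by split; [apply: sub_path fp | apply: sub_path fp'] => u v;
    rewrite lt_min => /andP[].
have k3 := partition_sum_near t0s tt1 pp'.
rewrite partition_sum_cat lpi in k2.
rewrite [X in `|X|](_ : _ = (ht - (partition_sum X t0 pi + partition_sum X s pi'))
   - (hs - partition_sum X t0 pi) + (partition_sum X s pi' - X s t)); last by ring.
apply: le_trans (ler_normD _ _) _.
apply: le_trans (lerD (ler_normB _ _) (lexx _)) _.
lra.
Qed.

End sewing.

(** Existence: if [X] is additive up to order [theta > 1], then it approximates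
    the increments of a path. The path is the limit of the sums of [X] over the
    partitions of [[t0, t]], as a function of [t]. *)
Lemma sewing (R : realType) (theta t0 t1 : R) (X : R -> R -> R) : 1 < theta ->
  holder3 theta t0 t1 (fun s u t => X s t - X s u - X u t) ->
  exists h : R -> R, holder2 theta t0 t1 (fun s t => h t - h s - X s t).
Proof.
move=> theta1 [C hC]; apply: (@sewing_bound _ _ _ _ _ theta1 (Num.max 0 C)).
  by rewrite le_max lexx.
move=> s u t ? ? ? ?; apply: le_trans (hC _ _ _ _ _ _ _) _ => //.
by rewrite ler_wpM2r ?powR_ge0// le_max lexx orbT.
Qed.

(** * Calculus of remainders *)

Section remainders.
Context {R : realType} {t0 t1 : R}.
Implicit Types (V : normedModType R) (a b : R).

Lemma holder2_eq V a (X Y : R -> R -> V) :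
  (forall s t, t0 <= s -> s <= t -> t <= t1 -> X s t = Y s t) ->
  holder2 a t0 t1 Y -> holder2 a t0 t1 X.
Proof. by move=> XY [C hC]; exists C => s t ? ? ?; rewrite XY//; exact: hC. Qed.

Lemma holder2_0 V a : holder2 a t0 t1 (fun _ _ => 0 : V).
Proof. by exists 0 => s t _ _ _; rewrite normr0 mul0r. Qed.

Lemma holder2D V a (X Y : R -> R -> V) :
  holder2 a t0 t1 X -> holder2 a t0 t1 Y ->
  holder2 a t0 t1 (fun s t => X s t + Y s t).
Proof.
move=> [C hC] [D hD]; exists (C + D) => s t ? ? ?.
by rewrite mulrDl (le_trans (ler_normD _ _))// lerD// ?hC ?hD.
Qed.

Lemma holder2N V a (X : R -> R -> V) :
  holder2 a t0 t1 X -> holder2 a t0 t1 (fun s t => - X s t).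
Proof. by move=> [C hC]; exists C => s t ? ? ?; rewrite normrN hC. Qed.

Lemma holder2B V a (X Y : R -> R -> V) :
  holder2 a t0 t1 X -> holder2 a t0 t1 Y ->
  holder2 a t0 t1 (fun s t => X s t - Y s t).
Proof. by move=> hX hY; apply: holder2D => //; exact: holder2N. Qed.

Lemma holder2_sum V (I : finType) a (X : I -> R -> R -> V) :
  (forall i, holder2 a t0 t1 (X i)) ->
  holder2 a t0 t1 (fun s t => \sum_i X i s t).
Proof.
move=> hX; elim: (index_enum I) => [|i l IH].
  by apply: holder2_eq (holder2_0 V a) => s t _ _ _; rewrite big_nil.
by apply: holder2_eq (holder2D (hX i) IH) => s t _ _ _; rewrite big_cons.
Qed.

Lemma holder2Zl V a (X : R -> R -> R) (v : V) :
  holder2 a t0 t1 X -> holder2 a t0 t1 (fun s t => X s t *: v).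
Proof.
move=> [C hC]; exists (C * `|v|) => s t ? ? ?.
by rewrite normrZ mulrAC ler_wpM2r// hC.
Qed.

(** Order 0 means bounded, so that this also covers a bounded factor. *)
Lemma holder2M a b (X Y : R -> R -> R) : 0 <= a -> 0 <= b ->
  holder2 a t0 t1 X -> holder2 b t0 t1 Y ->
  holder2 (a + b) t0 t1 (fun s t => X s t * Y s t).
Proof.
move=> a0 b0 /holder2_pos[C C0 hC] /holder2_pos[D D0 hD].
exists (C * D) => s t ? ? ?.
have -> : (t - s) `^ (a + b) = (t - s) `^ a * (t - s) `^ b.
  have [/eqP|abN0] := eqVneq (a + b) 0; last by rewrite powRD// (negPf abN0).
  by rewrite paddr_eq0// => /andP[/eqP -> /eqP ->]; rewrite addr0 powRr0 mulr1.
by rewrite normrM mulrACA ler_pM// ?hC ?hD.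
Qed.

Lemma holder2W V a b (X : R -> R -> V) : 0 <= a -> a <= b ->
  holder2 b t0 t1 X -> holder2 a t0 t1 X.
Proof.
move=> a0 ab /holder2_pos[C C0 hC]; exists (C * (t1 - t0) `^ (b - a)) => s t t0s st tt1.
apply: le_trans (hC _ _ t0s st tt1) _; rewrite -mulrA ler_wpM2l//.
have [seqt|sNt] := eqVneq s t.
  subst t; rewrite subrr; have [b0|bN0] := eqVneq b 0; last first.
    by rewrite powR0// mulr_ge0 ?powR_ge0.
  have -> : a = 0 by lra.
  by rewrite b0 subrr !powRr0 mulr1.
have ts0 : t - s != 0 by rewrite subr_eq0 eq_sym.
have -> : (t - s) `^ b = (t - s) `^ (b - a) * (t - s) `^ a.
  by rewrite -powRD ?subrK// ts0 implybT.
rewrite ler_wpM2r ?powR_ge0// ge0_ler_powR ?nnegrE ?subr_ge0//.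
- by rewrite (le_trans t0s)// (le_trans st).
- by rewrite lerB.
Qed.

Lemma holder_bounded V a (Y : R -> V) : 0 <= a -> holder a t0 t1 Y ->
  holder2 0 t0 t1 (fun s _ => Y s).
Proof.
move=> a0 /(holder2W (lexx 0) a0)[C hC]; exists (C + `|Y t0|) => s t t0s st tt1.
rewrite powRr0 mulr1 -[in leLHS](subrK (Y t0) (Y s)).
apply: le_trans (ler_normD _ _) _; rewrite lerD2r.
by have := hC _ _ (lexx _) t0s (le_trans st tt1); rewrite powRr0 mulr1.
Qed.

Lemma holderD V a (X Y : R -> V) : holder a t0 t1 X -> holder a t0 t1 Y ->
  holder a t0 t1 (fun t => X t + Y t).
Proof.
move=> hX hY; apply: holder2_eq (holder2D hX hY) => s t _ _ _.
by rewrite opprD addrACA.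
Qed.

Lemma holderM a (X Y : R -> R) : 0 <= a ->
  holder a t0 t1 X -> holder a t0 t1 Y -> holder a t0 t1 (fun t => X t * Y t).
Proof.
move=> a0 hX hY.
have bX := holder_bounded a0 hX; have bY := holder_bounded a0 hY.
have a2 : a <= a + a by rewrite lerDl.
have h1 := holder2M (lexx 0) a0 bX hY; have h2 := holder2M (lexx 0) a0 bY hX.
have h3 := holder2W a0 a2 (holder2M a0 a0 hX hY).
rewrite add0r in h1 h2.
by apply: holder2_eq (holder2D (holder2D h1 h2) h3) => s t _ _ _; ring.
Qed.

Lemma holder_sum V (I : finType) a (X : I -> R -> V) :
  (forall i, holder a t0 t1 (X i)) -> holder a t0 t1 (fun t => \sum_i X i t).
Proof.
move=> hX; apply: holder2_eq (holder2_sum hX) => s t _ _ _.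
by rewrite sumrB.
Qed.

Lemma norm_entry_le (m n : nat) (A : 'M[R]_(m, n)) i j : `|A i j| <= `|A|.
Proof.
rewrite [leRHS]/Num.norm /= mx_normrE; apply/bigmax_geP; right => /=.
by exists (i, j).
Qed.

Lemma holder2_entry (m n : nat) a (X : R -> R -> 'M[R]_(m, n)) i j :
  holder2 a t0 t1 X -> holder2 a t0 t1 (fun s t => X s t i j).
Proof.
by move=> [C hC]; exists C => s t ? ? ?; apply: le_trans (norm_entry_le _ _ _) (hC _ _ _ _ _).
Qed.

Lemma holder2_mx (m n : nat) a (X : R -> R -> 'M[R]_(m, n)) :
  (forall i j, holder2 a t0 t1 (fun s t => X s t i j)) -> holder2 a t0 t1 X.
Proof.
move=> hX.
have h : holder2 a t0 t1 (fun s t => \sum_i \sum_j X s t i j *: delta_mx i j : 'M[R]_(m, n)).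
  by apply: holder2_sum => i; apply: holder2_sum => j; exact: holder2Zl.
by apply: holder2_eq h => s t _ _ _; exact: matrix_sum_delta.
Qed.

End remainders.

(** * Controlled paths *)

Section controlled.
Context {R : realType} {K : nat} {alpha t0 t1 : R} {Z : rough_path R K}.
Hypothesis alpha_ge0 : 0 <= alpha.
Hypothesis holderZ : holder alpha t0 t1 (rp1 Z).
Local Notation ctrl := (controlled alpha t0 t1 Z).

Lemma holder2_rp_incr i : holder2 alpha t0 t1 (fun s t => rp_incr Z s t i 0).
Proof. exact: holder2_entry. Qed.

Lemma controlled_sum (I : finType) (Y : I -> R -> R) (Y' : I -> R -> 'I_K -> R) :
  (forall i, ctrl (Y i) (Y' i)) ->
  ctrl (fun t => \sum_i Y i t) (fun t k => \sum_i Y' i t k).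
Proof.
move=> hY; split.
- by apply: holder_sum => i; have [] := hY i.
- by move=> k; apply: holder_sum => i; have [_ + _] := hY i; exact.
- have h : holder2 (2 * alpha) t0 t1 (fun s t => \sum_i
      (Y i t - Y i s - \sum_k rp_incr Z s t k 0 *: Y' i s k)).
    by apply: holder2_sum => i; have [] := hY i.
  apply: holder2_eq h => s t _ _ _; rewrite !sumrB; congr (_ - _ - _).
  by rewrite exchange_big; apply: eq_bigr => k _; rewrite scaler_sumr.
Qed.

Lemma controlledD (X Y : R -> R) (X' Y' : R -> 'I_K -> R) : ctrl X X' -> ctrl Y Y' ->
  ctrl (fun t => X t + Y t) (fun t k => X' t k + Y' t k).
Proof.
move=> [hX hX' rX] [hY hY' rY]; split; first exact: holderD.
  by move=> k; apply: holderD.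
apply: holder2_eq (holder2D rX rY) => s t _ _ _.
have -> : \sum_i rp_incr Z s t i 0 *: (X' s i + Y' s i) =
  \sum_i rp_incr Z s t i 0 *: X' s i + \sum_i rp_incr Z s t i 0 *: Y' s i.
  by rewrite -big_split; apply: eq_bigr => i _; rewrite scalerDr.
ring.
Qed.

(** Leibniz rule; the product of the two increments is of order
    [2 * alpha] and goes into the remainder. *)
Lemma controlledM (X Y : R -> R) (X' Y' : R -> 'I_K -> R) : ctrl X X' -> ctrl Y Y' ->
  ctrl (fun t => X t * Y t) (fun t k => X' t k * Y t + X t * Y' t k).
Proof.
move=> [hX hX' rX] [hY hY' rY]; split; first exact: holderM.
  by move=> k; apply: holderD; exact: holderM.
have bX := holder_bounded alpha_ge0 hX; have bY := holder_bounded alpha_ge0 hY.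
have a2 : 0 <= 2 * alpha by rewrite mulr_ge0.
have h1 := holder2M (lexx 0) a2 bX rY; have h2 := holder2M (lexx 0) a2 bY rX.
have h3 := holder2M alpha_ge0 alpha_ge0 hX hY.
rewrite add0r in h1 h2; rewrite -mulr2n -mulr_natl in h3.
apply: holder2_eq (holder2D (holder2D h1 h2) h3) => s t _ _ _.
have -> : \sum_i rp_incr Z s t i 0 *: (X' s i * Y s + X s * Y' s i) =
  Y s * (\sum_i rp_incr Z s t i 0 *: X' s i) +
  X s * (\sum_i rp_incr Z s t i 0 *: Y' s i).
  rewrite !mulr_sumr -big_split; apply: eq_bigr => i _ /=.
  by rewrite /GRing.scale /=; ring.
ring.
Qed.

(** To third order, the product of two increments only depends on the
    Gubinelli derivatives. *)
Lemma controlled_increment_product (X Y : R -> R) (X' Y' : R -> 'I_K -> R) :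
  ctrl X X' -> ctrl Y Y' ->
  holder2 (3 * alpha) t0 t1 (fun s t => (X t - X s) * (Y t - Y s)
    - (\sum_i rp_incr Z s t i 0 * X' s i) * (\sum_i rp_incr Z s t i 0 * Y' s i)).
Proof.
move=> [hX _ rX] [hY _ rY].
have a2 : 0 <= 2 * alpha by rewrite mulr_ge0.
have a3 : 0 <= 3 * alpha by rewrite mulr_ge0.
have h1 := holder2M alpha_ge0 a2 hX rY.
have h2 := holder2M a2 alpha_ge0 rX hY.
have h3 := holder2M a2 a2 rX rY.
have e1 : alpha + 2 * alpha = 3 * alpha by ring.
have e2 : 2 * alpha + alpha = 3 * alpha by ring.
have e3 : 3 * alpha <= 2 * alpha + 2 * alpha by have := alpha_ge0; lra.
rewrite e1 in h1; rewrite e2 in h2; have {}h3 := holder2W a3 e3 h3.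
apply: holder2_eq (holder2B (holder2D h1 h2) h3) => s t _ _ _.
rewrite /GRing.scale /=; move: (\sum_i _ * X' s i) (\sum_i _ * Y' s i) => x y.
ring.
Qed.

Lemma controlled_entry (m n : nat) (Y : R -> 'M[R]_(m, n))
    (Y' : R -> 'I_K -> 'M[R]_(m, n)) i j :
  ctrl Y Y' -> ctrl (fun t => Y t i j) (fun t k => Y' t k i j).
Proof.
move=> [hY hY' rY]; split.
- by apply: holder2_eq (holder2_entry i j hY) => s t _ _ _; rewrite !mxE.
- by move=> k; apply: holder2_eq (holder2_entry i j (hY' k)) => s t _ _ _; rewrite !mxE.
- apply: holder2_eq (holder2_entry i j rY) => s t _ _ _.
  by rewrite !mxE summxE; congr (_ - _ - _); apply: eq_bigr => k _; rewrite !mxE.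
Qed.

Lemma controlled_mx (m n : nat) (Y : R -> 'M[R]_(m, n))
    (Y' : R -> 'I_K -> 'M[R]_(m, n)) :
  (forall i j, ctrl (fun t => Y t i j) (fun t k => Y' t k i j)) -> ctrl Y Y'.
Proof.
move=> h; split.
- apply: holder2_mx => i j; have [hY _ _] := h i j.
  by apply: holder2_eq hY => s t _ _ _; rewrite !mxE.
- move=> k; apply: holder2_mx => i j; have [_ hY _] := h i j.
  by apply: holder2_eq (hY k) => s t _ _ _; rewrite !mxE.
- apply: holder2_mx => i j; have [_ _ hY] := h i j.
  apply: holder2_eq hY => s t _ _ _.
  by rewrite !mxE summxE; congr (_ - _ - _); apply: eq_bigr => k _; rewrite !mxE.
Qed.

End controlled.

(** * Rough integrals *)

Section holder3.
Context {R : realType} {t0 t1 : R}.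

Lemma holder3_eq a (X Y : R -> R -> R -> R) :
  (forall s u t, t0 <= s -> s <= u -> u <= t -> t <= t1 -> X s u t = Y s u t) ->
  holder3 a t0 t1 Y -> holder3 a t0 t1 X.
Proof. by move=> XY [C hC]; exists C => s u t ? ? ? ?; rewrite XY//; exact: hC. Qed.

Lemma holder3D a (X Y : R -> R -> R -> R) :
  holder3 a t0 t1 X -> holder3 a t0 t1 Y ->
  holder3 a t0 t1 (fun s u t => X s u t + Y s u t).
Proof.
move=> [C hC] [D hD]; exists (C + D) => s u t ? ? ? ?.
by rewrite mulrDl (le_trans (ler_normD _ _))// lerD// ?hC ?hD.
Qed.

Lemma holder3N a (X : R -> R -> R -> R) :
  holder3 a t0 t1 X -> holder3 a t0 t1 (fun s u t => - X s u t).
Proof. by move=> [C hC]; exists C => s u t ? ? ? ?; rewrite normrN hC. Qed.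

Lemma holder3_sum (I : finType) a (X : I -> R -> R -> R -> R) :
  (forall i, holder3 a t0 t1 (X i)) ->
  holder3 a t0 t1 (fun s u t => \sum_i X i s u t).
Proof.
move=> hX; elim: (index_enum I) => [|i l IH].
  by exists 0 => s u t _ _ _ _; rewrite big_nil normr0 mul0r.
by apply: holder3_eq (holder3D (hX i) IH) => s u t _ _ _ _; rewrite big_cons.
Qed.

Lemma holder3M a b (X Y : R -> R -> R) : 0 < a -> 0 < b ->
  holder2 a t0 t1 X -> holder2 b t0 t1 Y ->
  holder3 (a + b) t0 t1 (fun s u t => X s u * Y u t).
Proof.
move=> a0 b0 /holder2_pos[C C0 hC] /holder2_pos[D D0 hD].
exists (C * D) => s u t t0s su ut tt1.
have ut1 : u <= t1 := le_trans ut tt1; have t0u : t0 <= u := le_trans t0s su.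
rewrite powRD; last by rewrite (gt_eqF (addr_gt0 a0 b0)).
rewrite normrM mulrACA ler_pM//.
  apply: le_trans (hC _ _ t0s su ut1) _.
  rewrite ler_wpM2l// ge0_ler_powR ?nnegrE ?subr_ge0 ?(ltW a0) ?lerB//.
  exact: le_trans su ut.
apply: le_trans (hD _ _ t0u ut tt1) _.
rewrite ler_wpM2l// ge0_ler_powR ?nnegrE ?subr_ge0 ?(ltW b0) ?lerB//.
exact: le_trans su ut.
Qed.

End holder3.

Lemma cvg_mx_entry (R : realType) (m n : nat) (T : Type) (F : set_system T)
    (FF : Filter F) (f : T -> 'M[R]_(m, n)) (l : 'M[R]_(m, n)) :
  (forall i j, f x i j @[x --> F] --> l i j) -> f x @[x --> F] --> l.
Proof.
move=> fl; apply/cvg_ballP => e e0.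
have : \forall x \near F, forall i j, ball (l i j) e (f x i j).
  by apply: filter_forall => i; apply: filter_forall => j; exact: (cvg_ball (fl i j)).
by apply: filterS => x h; split.
Qed.

Definition rough_germ (R : realType) (K m : nat) (Z : rough_path R K)
    (C : R -> 'M[R]_(m, K))
    (C' : R -> 'I_K -> 'M[R]_(m, K)) (s t : R) (l : 'I_m) : R :=
  \sum_j C s l j * rp_incr Z s t j 0
  + \sum_i \sum_j C' s i l j * rp2 Z s t i j.

Section rough_integral.
Context {R : realType} {K : nat} {alpha t0 t1 : R} {Z : rough_path R K}.
Hypothesis alpha_gt : 3^-1 < alpha.
Hypothesis hZ : geometric_rough_path alpha t0 t1 Z.

Let alpha_gt0 : 0 < alpha. Proof. by apply: lt_trans alpha_gt; rewrite invr_gt0. Qed.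

Let alpha3_gt1 : 1 < 3 * alpha.
Proof. by rewrite mulrC -ltr_pdivrMr// mul1r. Qed.

Lemma rough_sum_entry m (C : R -> 'M[R]_(m, K)) C' s pi l :
  rough_sum Z C C' s pi l 0 =
  partition_sum (fun u v => rough_germ Z C C' u v l) s pi.
Proof.
rewrite /rough_sum /partition_sum summxE; apply: eq_bigr => -[u v] _ /=.
rewrite !mxE summxE; congr (_ + _); apply: eq_bigr => i _.
by rewrite !mxE; apply: eq_bigr => j _; rewrite !mxE.
Qed.

(** A path whose increments have the germ of a rough integral as their local
    expansion identifies that integral, and proves its convergence. *)
Lemma rough_sum_cvg m (C : R -> 'M[R]_(m, K)) C' (h : R -> 'cV[R]_m) :
  (forall l, holder2 (3 * alpha) t0 t1
     (fun s t => h t l 0 - h s l 0 - rough_germ Z C C' s t l)) ->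
  forall s t, t0 <= s -> s <= t -> t <= t1 ->
  rough_sum Z C C' s @ mesh_filter s t --> h t - h s.
Proof.
move=> hh s t t0s st tt1; apply: cvg_mx_entry => l j.
have := partition_sum_cvg alpha3_gt1 (hh l) t0s st tt1.
rewrite !mxE ord1 => hl.
by under eq_fun do rewrite rough_sum_entry.
Qed.

Lemma rough_int_eq m (C : R -> 'M[R]_(m, K)) C' (h : R -> 'cV[R]_m) :
  (forall l, holder2 (3 * alpha) t0 t1
     (fun s t => h t l 0 - h s l 0 - rough_germ Z C C' s t l)) ->
  forall s t, t0 <= s -> s <= t -> t <= t1 ->
  rough_int Z C C' s t = h t - h s.
Proof.
move=> hh s t t0s st tt1; have := mesh_filter_proper st => ?.
by apply: cvg_lim; [exact: norm_hausdorff | exact: rough_sum_cvg].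
Qed.

(** By Chen's relation the defect of additivity of the germ only contains the
    remainder of [C] against [Z], and the increment of [C'] against the second
    level of [Z]. *)
Lemma rough_germ_almost_additive m (C : R -> 'M[R]_(m, K)) C' l :
  controlled alpha t0 t1 Z C C' ->
  holder3 (3 * alpha) t0 t1 (fun s u t => rough_germ Z C C' s t l
    - rough_germ Z C C' s u l - rough_germ Z C C' u t l).
Proof.
case: hZ => holderZ holderZZ chen _ [_ hC' rC].
have h1 : holder3 (3 * alpha) t0 t1 (fun s u t => \sum_j
   (C u - C s - \sum_i rp_incr Z s u i 0 *: C' s i) l j * rp_incr Z u t j 0).
  apply: holder3_sum => j.
  have -> : 3 * alpha = 2 * alpha + alpha by ring.
  apply: (@holder3M _ _ _ _ _ (fun s u => (C u - C s - \sum_i rp_incr Z s u i 0 *: C' s i) l j)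
    (fun u t => rp_incr Z u t j 0)) => //; first by rewrite mulr_gt0.
    exact: holder2_entry.
  exact: holder2_rp_incr.
have h2 : holder3 (3 * alpha) t0 t1 (fun s u t => \sum_i \sum_j
   (C' u i - C' s i) l j * rp2 Z u t i j).
  apply: holder3_sum => i; apply: holder3_sum => j.
  have -> : 3 * alpha = alpha + 2 * alpha by ring.
  apply: (@holder3M _ _ _ _ _ (fun s u => (C' u i - C' s i) l j)
    (fun u t => rp2 Z u t i j)) => //; first by rewrite mulr_gt0.
    exact: holder2_entry (hC' i).
  exact: holder2_entry.
apply: holder3_eq (holder3N (holder3D h1 h2)) => s u t t0s su ut tt1.
rewrite /rough_germ (chen _ _ _ t0s su ut tt1).
have E1 : \sum_j C s l j * rp_incr Z s t j 0 =
  \sum_j C s l j * rp_incr Z s u j 0 + \sum_j C s l j * rp_incr Z u t j 0.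
  by rewrite -big_split; apply: eq_bigr => j _; rewrite /rp_incr !mxE /=; ring.
have E2 : \sum_i \sum_j C' s i l j *
    (rp2 Z s u + rp2 Z u t + rp_incr Z s u *m (rp_incr Z u t)^T) i j =
  \sum_i \sum_j C' s i l j * rp2 Z s u i j + \sum_i \sum_j C' s i l j * rp2 Z u t i j
  + \sum_i \sum_j C' s i l j * (rp_incr Z s u i 0 * rp_incr Z u t j 0).
  rewrite -!big_split; apply: eq_bigr => i _; rewrite -!big_split.
  by apply: eq_bigr => j _; rewrite !mxE big_ord1 !mxE /=; ring.
have E3 : \sum_j (C u - C s - \sum_i rp_incr Z s u i 0 *: C' s i) l j * rp_incr Z u t j 0
  = \sum_j C u l j * rp_incr Z u t j 0 - \sum_j C s l j * rp_incr Z u t j 0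
  - \sum_i \sum_j C' s i l j * (rp_incr Z s u i 0 * rp_incr Z u t j 0).
  rewrite [X in _ = _ - X]exchange_big -!sumrB; apply: eq_bigr => j _ /=.
  rewrite !mxE summxE !mulrBl; congr (_ - _); rewrite mulr_suml.
  by apply: eq_bigr => i _; rewrite !mxE; ring.
have E4 : \sum_i \sum_j (C' u i - C' s i) l j * rp2 Z u t i j =
  \sum_i \sum_j C' u i l j * rp2 Z u t i j - \sum_i \sum_j C' s i l j * rp2 Z u t i j.
  rewrite -sumrB; apply: eq_bigr => i _; rewrite -sumrB.
  by apply: eq_bigr => j _; rewrite !mxE; ring.
rewrite E1 E2 E3 E4; ring.
Qed.

(** The sewing lemma, applied to each component of the germ. *)
Lemma rough_int_expansion m (C : R -> 'M[R]_(m, K)) C' :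
  controlled alpha t0 t1 Z C C' ->
  exists h : R -> 'cV[R]_m,
    (forall l, holder2 (3 * alpha) t0 t1
     (fun s t => h t l 0 - h s l 0 - rough_germ Z C C' s t l)) /\
    forall s t, t0 <= s -> s <= t -> t <= t1 -> rough_int Z C C' s t = h t - h s.
Proof.
move=> hC.
have /choice[h hh] : forall l, exists h : R -> R, holder2 (3 * alpha) t0 t1
     (fun s t => h t - h s - rough_germ Z C C' s t l).
  by move=> l; apply: sewing => //; exact: rough_germ_almost_additive.
have {}hh l : holder2 (3 * alpha) t0 t1 (fun s t => (\col_k h k t) l 0
    - (\col_k h k s) l 0 - rough_germ Z C C' s t l).
  by apply: holder2_eq (hh l) => s t _ _ _; rewrite !mxE.
by exists (fun t => \col_l h l t); split => //; exact: rough_int_eq.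
Qed.

End rough_integral.

(** * Smooth functions of controlled paths *)

Section smooth.
Context {R : realType} {n : nat}.
Implicit Types (F : 'cV[R]_n -> R) (x y v : 'cV[R]_n).

Lemma smooth_differentiable (W : normedModType R) (F : 'cV[R]_n -> W) x :
  smooth F -> differentiable F x.
Proof. by move=> /(_ [::] x). Qed.

Lemma smooth_partial (W : normedModType R) (F : 'cV[R]_n -> W) i :
  smooth F -> smooth (partial i F).
Proof.
move=> sF vs x; have := sF (rcons vs (delta_mx i 0)) x.
by rewrite foldr_rcons.
Qed.

Lemma derive_entry (m k : nat) (F : 'cV[R]_n -> 'M[R]_(m, k)) x v i j :
  differentiable F x -> 'D_v (fun y => F y i j) x = ('D_v F x) i j.
Proof. by move=> dF; rewrite derive_mx ?mxE//; exact: diff_derivable. Qed.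

Lemma smooth_entry (m k : nat) (F : 'cV[R]_n -> 'M[R]_(m, k)) i j :
  smooth F -> smooth (fun x => F x i j).
Proof.
move=> sF vs x.
have -> : foldr (fun v G => 'D_v G) (fun x => F x i j) vs =
    (fun x => foldr (fun v G => 'D_v G) F vs x i j).
  elim: vs => //= v vs ->; apply/funext => y.
  by rewrite derive_entry//; exact: sF.
by apply: (@differentiable_comp _ _ _ _ (foldr _ F vs) (fun A : 'M[R]_(m, k) => A i j));
  [exact: sF | exact: differentiable_coord].
Qed.

Lemma derive_partial F x v : differentiable F x ->
  'D_v F x = \sum_i v i 0 * partial i F x.
Proof.
move=> dF; rewrite deriveE// [in LHS](matrix_sum_delta v) linear_sum.
apply: eq_bigr => i _; rewrite big_ord1 linearZ /=.
by rewrite /partial deriveE.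
Qed.

(** The ball lies in a compact box. *)
Lemma bounded_on_ball F M : continuous F ->
  exists B, forall x, `|x| <= M -> `|F x| <= B.
Proof.
move=> cF.
pose A : set 'rV[R]_n := [set u | forall i, `[-M, M]%classic (u ord0 i)].
have cA : compact A.
  by apply: (@rV_compact R n (fun=> `[-M, M]%classic)) => _; exact: segment_compact.
have cT : continuous (fun u : 'rV[R]_n => F u^T).
  move=> u; apply: (@continuous_comp _ _ _ (fun w : 'rV[R]_n => w^T) F); last exact: cF.
  apply: (@cvg_mx_entry R n 1 _ (nbhs u) _ (fun w : 'rV[R]_n => w^T) u^T) => i j.
  rewrite mxE.
  under eq_fun do rewrite mxE.
  exact: coord_continuous.
have /compact_bounded[B [_ hB]] := continuous_compact (continuous_subspaceT cT) cA.
exists (B + 1) => x xM; apply: (hB (B + 1)); first by rewrite ltrDl.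
exists x^T; last by rewrite trmxK.
move=> i; rewrite mxE /= in_itv /= -ler_norml.
exact: le_trans (norm_entry_le _ _ _) xM.
Qed.

Lemma mean_value F x y : (forall z, differentiable F z) ->
  exists2 c : R, 0 <= c <= 1 &
    F y - F x = 'D_(y - x) F (x + c *: (y - x)).
Proof.
move=> dF; set v := y - x.
have D (c : R) : is_derive c 1 (fun h : R => F (x + h *: v)) ('D_v F (x + c *: v)).
  have Dv : derivable F (x + c *: v) v by exact/diff_derivable.
  have E : (fun h : R => h^-1 *: (((fun h : R => F (x + h *: v)) \o shift c) (h *: 1)
      - F (x + c *: v))) =
    (fun h : R => h^-1 *: ((F \o shift (x + c *: v)) (h *: v) - F (x + c *: v))).
    apply/funext => h /=; congr (_ *: (F _ - _)).
    by rewrite [h%:A]mulr1 scalerDl addrCA.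
  by apply: DeriveDef; rewrite /derivable /derive E.
have [c c01 E] : exists2 c : R, c \in `[0, 1] &
    F (x + 1 *: v) - F (x + 0 *: v) = 'D_v F (x + c *: v) * (1 - 0).
  apply: (@MVT_segment R (fun h => F (x + h *: v)) (fun h => 'D_v F (x + h *: v))) => //.
  by apply: derivable_within_continuous => c _; exact: ex_derive.
exists c; first by move: c01; rewrite in_itv.
by move: E; rewrite scale1r scale0r addr0 subr0 mulr1 /v [x + (y - x)]addrC subrK.
Qed.

Lemma norm_segment_le M x y (c : R) : 0 <= c <= 1 -> `|x| <= M -> `|y| <= M ->
  `|x + c *: (y - x)| <= M.
Proof.
move=> /andP[c0 c1] xM yM.
have -> : x + c *: (y - x) = (1 - c) *: x + c *: y.
  by rewrite scalerBr scalerBl scale1r addrCA addrC addrAC.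
apply: le_trans (ler_normD _ _) _; rewrite !normrZ.
rewrite ger0_norm ?subr_ge0// (ger0_norm c0).
rewrite [leRHS](_ : M = (1 - c) * M + c * M); last by ring.
by rewrite lerD// ler_wpM2l// subr_ge0.
Qed.

Lemma smooth_lipschitz F M : smooth F ->
  exists2 B, 0 <= B & forall x y, `|x| <= M -> `|y| <= M ->
    `|F y - F x| <= B * `|y - x|.
Proof.
move=> sF.
have /choice[B hB] : forall i : 'I_n, exists B, forall x, `|x| <= M -> `|partial i F x| <= B.
  move=> i; apply: bounded_on_ball => x; apply: differentiable_continuous.
  exact/smooth_differentiable/smooth_partial.
exists (\sum_i `|B i|) => [|x y xM yM]; first exact: sumr_ge0.
have [|c c01 ->] := @mean_value F x y; first by move=> z; exact: smooth_differentiable.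
rewrite derive_partial; last exact: smooth_differentiable.
apply: le_trans (ler_norm_sum _ _ _) _; rewrite mulr_suml ler_sum// => i _.
rewrite normrM mulrC ler_pM ?norm_entry_le//.
by apply: le_trans (hB _ _ _) (ler_norm _); exact: norm_segment_le.
Qed.

(** The partial derivatives in the mean value theorem differ from those at [x]
    by a Lipschitz error. *)
Lemma smooth_taylor F M : smooth F ->
  exists B, forall x y, `|x| <= M -> `|y| <= M ->
    `|F y - F x - 'D_(y - x) F x| <= B * `|y - x| ^+ 2.
Proof.
move=> sF.
have /choice[B hB] : forall i : 'I_n, exists B, 0 <= B /\ forall x y,
    `|x| <= M -> `|y| <= M -> `|partial i F y - partial i F x| <= B * `|y - x|.
  by move=> i; have [B B0 hB] := smooth_lipschitz M (smooth_partial i sF); exists B.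
exists (\sum_i B i) => x y xM yM.
have [|c c01 ->] := @mean_value F x y; first by move=> z; exact: smooth_differentiable.
rewrite !derive_partial; try exact: smooth_differentiable.
rewrite -sumrB; apply: le_trans (ler_norm_sum _ _ _) _.
rewrite mulr_suml ler_sum// => i _; have [B0 {}hB] := hB i.
rewrite -mulrBr normrM expr2 mulrCA ler_pM ?norm_entry_le//.
apply: le_trans (hB _ _ xM _) _; first exact: norm_segment_le.
rewrite ler_wpM2l// addrC addKr normrZ; case/andP: c01 => c0 c1.
by rewrite ger0_norm// ler_piMl.
Qed.

End smooth.

Section controlled_smooth.
Context {R : realType} {n K : nat} {alpha t0 t1 : R} {Z : rough_path R K}.
Hypothesis alpha_ge0 : 0 <= alpha.
Context {q : R -> 'cV[R]_n}.
Implicit Types F : 'cV[R]_n -> R.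

Lemma path_bounded : holder alpha t0 t1 q ->
  exists M, forall t, t0 <= t -> t <= t1 -> `|q t| <= M.
Proof.
move=> /(holder_bounded alpha_ge0)[M hM]; exists M => t t0t tt1.
by have := hM t t t0t (lexx t) tt1; rewrite powRr0 mulr1.
Qed.

Lemma holder_smooth F : smooth F -> holder alpha t0 t1 q ->
  holder alpha t0 t1 (fun t => F (q t)).
Proof.
move=> sF hq; have [M hM] := path_bounded hq; case: hq => C hC.
have [B B0 hB] := smooth_lipschitz M sF.
exists (B * C) => s t t0s st tt1.
apply: le_trans (hB _ _ _ _) _.
- exact: hM t0s (le_trans st tt1).
- exact: hM (le_trans t0s st) tt1.
- by rewrite -mulrA ler_wpM2l// hC.
Qed.

Lemma holder2_taylor F : smooth F -> holder alpha t0 t1 q ->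
  holder2 (2 * alpha) t0 t1 (fun s t => F (q t) - F (q s) - 'D_(q t - q s) F (q s)).
Proof.
move=> sF hq; have [M hM] := path_bounded hq; case/holder2_pos: hq => C C0 hC.
have [B hB] := smooth_taylor M sF.
exists (`|B| * C ^+ 2) => s t t0s st tt1.
apply: le_trans (hB _ _ _ _) _.
- exact: hM t0s (le_trans st tt1).
- exact: hM (le_trans t0s st) tt1.
- have h : `|q t - q s| ^+ 2 <= (C * (t - s) `^ alpha) ^+ 2.
    by rewrite ler_pXn2r ?nnegrE ?mulr_ge0 ?powR_ge0 ?hC.
  rewrite [2 * _]mulrC powRrM powR_mulrn ?powR_ge0// -mulrA -exprMn.
  apply: le_trans (ler_wpM2r _ (ler_norm B)) _; first exact: exprn_ge0.
  exact: ler_wpM2l h.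
Qed.

(** Chain rule: the remainder is the Taylor remainder plus the differential
    applied to the remainder of [q]. *)
Lemma controlled_smooth F (q' : R -> 'I_K -> 'cV[R]_n) : smooth F ->
  controlled alpha t0 t1 Z q q' ->
  controlled alpha t0 t1 Z (fun t => F (q t)) (comp_gub F q q').
Proof.
move=> sF [hq hq' rq].
have dF x : differentiable F x by exact: smooth_differentiable.
split; first exact: holder_smooth.
  move=> k; have h : holder alpha t0 t1
      (fun t => \sum_i q' t k i 0 * partial i F (q t)).
    apply: holder_sum => i; apply: holderM => //.
      by apply: holder2_eq (holder2_entry i 0 (hq' k)) => s t _ _ _; rewrite !mxE.
    by apply: holder_smooth => //; exact: smooth_partial.
  by apply: holder2_eq h => s t _ _ _; rewrite /comp_gub !derive_partial.
have a2 : 0 <= 2 * alpha by rewrite mulr_ge0.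
have h : holder2 (2 * alpha) t0 t1 (fun s t => \sum_i
    (q t - q s - \sum_k rp_incr Z s t k 0 *: q' s k) i 0 * partial i F (q s)).
  apply: holder2_sum => i; rewrite -[2 * alpha]addr0.
  apply: (@holder2M _ _ _ _ _ (fun s t =>
    (q t - q s - \sum_k rp_incr Z s t k 0 *: q' s k) i 0)
    (fun s t => partial i F (q s))) => //; first exact: holder2_entry.
  by apply: (holder_bounded alpha_ge0); apply: holder_smooth => //; exact: smooth_partial.
apply: holder2_eq (holder2D (holder2_taylor sF hq) h) => s t _ _ _.
rewrite -[X in _ = _ + X]derive_partial// !deriveE//.
have E v : 'd F (q s) (v - \sum_k rp_incr Z s t k 0 *: q' s k) =
    'd F (q s) v - \sum_k 'd F (q s) (rp_incr Z s t k 0 *: q' s k).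
  by rewrite linearB linear_sum.
rewrite E addrA subrK; congr (_ - _).
by apply: eq_bigr => k _; rewrite linearZ /comp_gub deriveE.
Qed.

End controlled_smooth.

(** * Coefficients affine in their second argument *)

Section affine_form.
Context {R : realType} {n : nat}.

(** Each entry of the coefficients of the costate and of the variation, and each
    running cost paired with the variation, is such a function of the state and
    of the other unknown. *)
Definition affine_form (a : 'I_n -> 'cV[R]_n -> R) (b : 'cV[R]_n -> R)
    (x : 'cV[R]_n * 'cV[R]_n) : R :=
  \sum_i a i x.1 * x.2 i 0 + b x.1.

Lemma is_derive_affine_form (a : 'I_n -> 'cV[R]_n -> R) (b : 'cV[R]_n -> R)
    (x y v w : 'cV[R]_n) :
  (forall i, differentiable (a i) x) -> differentiable b x ->
  is_derive (x, y) (v, w) (affine_form a b)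
    (\sum_i ('D_v (a i) x * y i 0 + a i x * w i 0) + 'D_v b x).
Proof.
move=> da db.
have Dfst (g : 'cV[R]_n -> R) : differentiable g x ->
    is_derive (x, y) (v, w) (fun z : 'cV[R]_n * 'cV[R]_n => g z.1) ('D_v g x).
  by move=> /(@diff_derivable _ _ _ _ _ v) dg; split.
have Dsnd i : is_derive (x, y) (v, w) (fun z : 'cV[R]_n * 'cV[R]_n => z.2 i 0) (w i 0).
  split.
    exact: (@diff_derivable _ _ _ _ _ w (@differentiable_coord R n 1 y i 0)).
  transitivity ('D_w (fun z : 'cV[R]_n => z i 0) y); first by [].
  by rewrite (@derive_entry R n n 1 id)// derive_id.
have Da i := Dfst _ (da i); have Db := Dfst _ db.
pose fa i (z : 'cV[R]_n * 'cV[R]_n) : R := a i z.1.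
pose fy i (z : 'cV[R]_n * 'cV[R]_n) : R := z.2 i 0.
have -> : affine_form a b = (\sum_i (fa i * fy i)) + (fun z => b z.1).
  apply/funext => z; rewrite /affine_form /= !fctE fct_sumE.
  by congr (_ + _); apply: eq_bigr.
apply: is_derive_eq; congr (_ + _); apply: eq_bigr => i _.
by rewrite /GRing.scale /= addrC mulrC.
Qed.

Context {K : nat} {alpha t0 t1 : R} {Z : rough_path R K}.
Hypothesis alpha_ge0 : 0 <= alpha.

Lemma controlled_affine_form (a : 'I_n -> 'cV[R]_n -> R) (b : 'cV[R]_n -> R)
    (q y : R -> 'cV[R]_n) (q' y' : R -> 'I_K -> 'cV[R]_n) :
  (forall i, smooth (a i)) -> smooth b ->
  controlled alpha t0 t1 Z q q' -> controlled alpha t0 t1 Z y y' ->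
  controlled alpha t0 t1 Z (fun t => affine_form a b (q t, y t))
    (comp_gub (affine_form a b) (pair_path q y) (pair_gub q' y')).
Proof.
move=> sa sb hq hy.
have h : controlled alpha t0 t1 Z (fun t => affine_form a b (q t, y t))
    (fun t k => \sum_i (comp_gub (a i) q q' t k * y t i 0 + a i (q t) * y' t k i 0)
      + comp_gub b q q' t k).
  apply: controlledD; last exact: controlled_smooth.
  apply: controlled_sum => i; apply: controlledM => //.
    exact: controlled_smooth.
  exact: controlled_entry.
suff -> : comp_gub (affine_form a b) (pair_path q y) (pair_gub q' y') =
   (fun t k => \sum_i (comp_gub (a i) q q' t k * y t i 0 + a i (q t) * y' t k i 0)
      + comp_gub b q q' t k) by [].
apply/funext => t; apply/funext => k; rewrite {1}/comp_gub /pair_path /pair_gub.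
have D := @is_derive_affine_form a b (q t) (y t) (q' t k) (y' t k)
  (fun i => smooth_differentiable _ (sa i)) (smooth_differentiable _ sb).
by rewrite derive_val.
Qed.

End affine_form.

(** * Drift integrals *)

Section drift.
Context {R : realType} {t0 t1 a : R} {b : R -> R}.
Hypothesis a_gt0 : 0 < a.
Hypothesis holder_b : holder a t0 t1 b.
Local Notation mu := (@lebesgue_measure R).

Lemma holder_continuous : {within `[t0, t1], continuous b}.
Proof.
have [C C0 hC] := holder2_pos holder_b.
apply/subspace_continuousP => x /=; rewrite in_itv /= => /andP[t0x xt1].
apply/cvgrPdist_lt => e e0; rewrite near_withinE.
have C10 : 0 < C + 1 by rewrite ltr_wpDl.
pose d := (e / (C + 1)) `^ a^-1.
have d0 : 0 < d by rewrite powR_gt0 ?divr_gt0.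
have bound u v : t0 <= u -> u <= v -> v <= t1 -> v - u < d -> `|b v - b u| < e.
  move=> t0u uv vt1 uvd; apply: le_lt_trans (hC _ _ t0u uv vt1) _.
  apply: (@le_lt_trans _ _ (C * (e / (C + 1)))).
    rewrite ler_wpM2l//.
    have -> : e / (C + 1) = d `^ a.
      by rewrite /d -powRrM mulVf ?gt_eqF// powRr1// divr_ge0 ?ltW.
    by rewrite ge0_ler_powR ?nnegrE ?subr_ge0 ?(ltW a_gt0) ?(ltW d0) ?(ltW uvd).
  by rewrite mulrCA gtr_pMr// ltr_pdivrMr// mul1r ltrDl.
exists d => //= y /=; rewrite /ball /= => xyd; rewrite in_itv /= => /andP[t0y yt1].
have [xy|yx] := leP x y.
  rewrite distrC; apply: bound => //.
  by move: xyd; rewrite distrC ger0_norm// subr_ge0.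
apply: bound => //; first exact: ltW.
by move: xyd; rewrite ger0_norm// subr_ge0 ltW.
Qed.

Lemma holder_integrable s t : t0 <= s -> t <= t1 ->
  mu.-integrable `[s, t] (EFin \o b).
Proof.
move=> t0s tt1; apply: continuous_compact_integrable; first exact: segment_compact.
apply: continuous_subspaceW holder_continuous => x /=.
by rewrite !in_itv /= => /andP[sx xt]; rewrite (le_trans t0s)// (le_trans xt).
Qed.

Lemma Rintegral_itv_chasles s u t : t0 <= s -> s <= u -> u <= t -> t <= t1 ->
  \int[mu]_(r in `[s, t]) b r =
  \int[mu]_(r in `[s, u]) b r + \int[mu]_(r in `[u, t]) b r.
Proof.
move=> t0s su ut tt1.
have h := @Rintegral_itvB R b (BLeft s) (BRight t) u (holder_integrable t0s tt1).
rewrite -[LHS](subrK (\int[mu]_(r in `[s, u]) b r)) h ?bnd_simp// addrC; congr (_ + _).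
rewrite Rintegral_itv_obnd_cbnd//.
apply: (integrableS _ _ _ (holder_integrable (le_trans t0s su) tt1)) => //.
exact: subset_itv_oc_cc.
Qed.

(** Up to an error of order [1 + a], the integral only sees the value of [b] at
    the left end, as [b] varies by an error of order [a]. *)
Lemma holder2_Rintegral :
  holder2 (1 + a) t0 t1 (fun s t => \int[mu]_(r in `[s, t]) b r - b s * (t - s)).
Proof.
have [C C0 hC] := holder2_pos holder_b; exists C => s t t0s st tt1.
have muE : fine (mu `[s, t]) = t - s.
  rewrite lebesgue_measure_itv /= lte_fin; case: ltgtP st => //= ->.
  by rewrite subrr.
have icst c : mu.-integrable `[s, t] (EFin \o (fun=> c)).
  apply: continuous_compact_integrable; first exact: segment_compact.
  by apply: continuous_subspaceT => x; exact: cvg_cst.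
rewrite -[in b s * _]muE -Rintegral_cst// -RintegralB//; last exact: holder_integrable.
have ib : mu.-integrable `[s, t] (EFin \o (fun r => b r - b s)).
  have := integrableB _ (holder_integrable t0s tt1) (icst (b s)).
  by apply.
apply: le_trans (le_normr_Rintegral _ ib) _ => //.
have -> : C * (t - s) `^ (1 + a) = \int[mu]_(r in `[s, t]) (C * (t - s) `^ a).
  rewrite Rintegral_cst// muE -mulrA [_ `^ a * _]mulrC.
  by rewrite -(@mulr_powRB1 _ _ (1 + a)) ?addr_gt0 ?subr_ge0// [1 + a]addrC addrK.
apply: le_Rintegral => //.
  exact: (integrable_norm ib).
move=> r /=; rewrite in_itv /= => /andP[sr rt].
apply: le_trans (hC _ _ t0s sr (le_trans rt tt1)) _; rewrite ler_wpM2l//.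
by rewrite ge0_ler_powR ?nnegrE ?subr_ge0 ?(ltW a_gt0) ?lerB ?(le_trans sr rt).
Qed.

End drift.

(** * Duality of the coefficients *)

Section duality.
Context {R : comRingType} {N K : nat}.

(** A matrix and its transpose are adjoint to each other; only the cost [l] is
    left. *)
Lemma duality_drift (F : 'I_N -> 'I_N -> R) (l p y : 'I_N -> R) :
  \sum_i p i * (\sum_j F i j * y j) - \sum_i y i * (\sum_j F j i * p j + l i)
  + \sum_i l i * y i = 0.
Proof.
have -> : \sum_i y i * (\sum_j F j i * p j + l i) =
    \sum_i p i * (\sum_j F i j * y j) + \sum_i l i * y i.
  have -> : \sum_i p i * (\sum_j F i j * y j) = \sum_i y i * (\sum_j F j i * p j).
    under eq_bigr do rewrite mulr_sumr; rewrite exchange_big /=.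
    by apply: eq_bigr => i _; rewrite mulr_sumr; apply: eq_bigr => j _; ring.
  by rewrite -big_split; apply: eq_bigr => i _ /=; ring.
ring.
Qed.

(** This is the identity of [duality_drift] for the diffusion coefficients,
    differentiated along the Gubinelli derivatives: those of [S], [lam], [y] and
    [p] are [dS], [dlam], [u] and [- v]. The terms in which [p] or [y] itself is
    differentiated in the pairing make up the third sum. *)
Lemma duality_second_level (S dS : 'I_N -> 'I_N -> R)
    (lam dlam p y u v : 'I_N -> R) :
  \sum_l p l * (\sum_a (dS a l * y a + S a l * u a))
  - \sum_l y l * (\sum_m (dS l m * p m + S l m * - v m) + dlam l)
  - \sum_l ((\sum_a S a l * y a) * v l + u l * (\sum_m p m * S l m + lam l))
  + \sum_a (dlam a * y a + lam a * u a) = 0.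
Proof.
have E1 : \sum_l p l * (\sum_a (dS a l * y a + S a l * u a)) =
    \sum_l \sum_m dS l m * y l * p m + \sum_l \sum_m S l m * u l * p m.
  under eq_bigr do rewrite mulr_sumr; rewrite exchange_big /= -big_split.
  apply: eq_bigr => l _; rewrite -big_split; apply: eq_bigr => m _ /=; ring.
have E2 : \sum_l y l * (\sum_m (dS l m * p m + S l m * - v m) + dlam l) =
    \sum_l \sum_m dS l m * y l * p m - \sum_l \sum_m S l m * y l * v m
    + \sum_l dlam l * y l.
  rewrite -sumrB -big_split; apply: eq_bigr => l _ /=.
  rewrite -sumrB mulrDr mulr_sumr [y l * dlam l]mulrC; congr (_ + _).
  by apply: eq_bigr => m _; ring.
have E3 : \sum_l ((\sum_a S a l * y a) * v l + u l * (\sum_m p m * S l m + lam l)) =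
    \sum_l \sum_m S l m * y l * v m
    + (\sum_l \sum_m S l m * u l * p m + \sum_l lam l * u l).
  rewrite big_split /=; congr (_ + _).
    under eq_bigr do rewrite mulr_suml.
    by rewrite exchange_big.
  rewrite -big_split; apply: eq_bigr => l _ /=.
  rewrite mulrDr mulr_sumr [u l * lam l]mulrC; congr (_ + _).
  by apply: eq_bigr => m _; ring.
rewrite E1 E2 E3 big_split /=; ring.
Qed.

(** Here [a] and [b] stand for the local expansions of the increments of [y] and
    of [- p], and [c] for that of the product of the increments of [y] and [p]:
    all sums but the last one are errors. *)
Lemma dotp_increment (p p' y y' a b c : 'I_N -> R) :
  \sum_l p' l * y' l - \sum_l p l * y l =
  \sum_l p l * (y' l - y l - a l) - \sum_l y l * (- (p' l - p l) - b l)
  + \sum_l ((y' l - y l) * (p' l - p l) - c l)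
  + \sum_l (p l * a l - y l * b l + c l).
Proof.
by rewrite -!sumrB -!big_split; apply: eq_bigr => l _ /=; ring.
Qed.

Lemma weighted_germ (w : 'I_N -> R) (C : 'I_N -> 'I_K -> R)
    (C' : 'I_K -> 'I_N -> 'I_K -> R) (z : 'I_K -> R) (W : 'I_K -> 'I_K -> R) :
  \sum_l w l * (\sum_j C l j * z j + \sum_i \sum_j C' i l j * W i j) =
  \sum_j (\sum_l w l * C l j) * z j + \sum_i \sum_j (\sum_l w l * C' i l j) * W i j.
Proof.
under eq_bigr do rewrite mulrDr; rewrite big_split /=; congr (_ + _).
  under eq_bigr do rewrite mulr_sumr; rewrite exchange_big /=.
  apply: eq_bigr => j _; rewrite mulr_suml; apply: eq_bigr => l _; ring.
under eq_bigr do rewrite mulr_sumr; rewrite exchange_big /=.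
apply: eq_bigr => i _; under eq_bigr do rewrite mulr_sumr.
rewrite exchange_big /=; apply: eq_bigr => j _; rewrite mulr_suml.
by apply: eq_bigr => l _; ring.
Qed.

(** Geometricity turns the product of two first-level terms into a
    second-level term. *)
Lemma first_level_product (A B : 'I_N -> 'I_K -> R) (z : 'I_K -> R)
    (W : 'I_K -> 'I_K -> R) :
  (forall i j, W i j + W j i = z i * z j) ->
  \sum_l (\sum_j z j * A l j) * (\sum_i z i * B l i) =
  \sum_i \sum_j (\sum_l (A l j * B l i + A l i * B l j)) * W i j.
Proof.
move=> hW; pose M i j := \sum_l A l j * B l i.
have -> : \sum_l (\sum_j z j * A l j) * (\sum_i z i * B l i) =
    \sum_i \sum_j M i j * (W i j + W j i).
  under eq_bigr do rewrite mulr_sumr; rewrite exchange_big /=.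
  apply: eq_bigr => i _; under eq_bigr do rewrite mulr_suml.
  rewrite exchange_big /=; apply: eq_bigr => j _.
  by rewrite hW mulr_suml; apply: eq_bigr => l _; ring.
have -> : \sum_i \sum_j M i j * (W i j + W j i) =
    \sum_i \sum_j M i j * W i j + \sum_i \sum_j M j i * W i j.
  have -> : \sum_i \sum_j M j i * W i j = \sum_i \sum_j M i j * W j i.
    exact: exchange_big.
  rewrite -big_split; apply: eq_bigr => i _ /=; rewrite -big_split.
  by apply: eq_bigr => j _ /=; ring.
rewrite -big_split; apply: eq_bigr => i _ /=; rewrite -big_split.
by apply: eq_bigr => j _ /=; rewrite -mulrDl -big_split.
Qed.

(** The left side is the main part in [dotp_increment] plus the germ of the
    running costs. Its terms are collected by [tau], [z] and [W], once the
    product of first-level terms is rewritten on the second level; the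
    hypotheses say that each of the three coefficients vanishes. *)
Lemma pairing_germ (p y bd bp : 'I_N -> R) (Cd Cp : 'I_N -> 'I_K -> R)
    (Cd' Cp' : 'I_K -> 'I_N -> 'I_K -> R) (c : 'I_K -> R)
    (c' : 'I_K -> 'I_K -> R) (psi tau : R) (z : 'I_K -> R)
    (W : 'I_K -> 'I_K -> R) :
  (forall i j, W i j + W j i = z i * z j) ->
  \sum_l p l * bd l - \sum_l y l * bp l + psi = 0 ->
  (forall j, \sum_l p l * Cd l j - \sum_l y l * Cp l j + c j = 0) ->
  (forall i j, \sum_l p l * Cd' i l j - \sum_l y l * Cp' i l j
     - \sum_l (Cd l j * Cp l i + Cd l i * Cp l j) + c' i j = 0) ->
  \sum_l (p l * (bd l * tau
             + (\sum_j Cd l j * z j + \sum_i \sum_j Cd' i l j * W i j))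
           - y l * (bp l * tau
             + (\sum_j Cp l j * z j + \sum_i \sum_j Cp' i l j * W i j))
           + (\sum_j z j * Cd l j) * (\sum_i z i * - Cp l i))
  + psi * tau + (\sum_j c j * z j + \sum_i \sum_j c' i j * W i j) = 0.
Proof.
move=> hW h0 h1 h2; rewrite big_split /= (first_level_product _ _ hW) sumrB.
have weighted (w b : 'I_N -> R) (C : 'I_N -> 'I_K -> R) (C' : 'I_K -> 'I_N -> 'I_K -> R) :
    \sum_l w l * (b l * tau + (\sum_j C l j * z j + \sum_i \sum_j C' i l j * W i j))
    = (\sum_l w l * b l) * tau + (\sum_j (\sum_l w l * C l j) * z j
      + \sum_i \sum_j (\sum_l w l * C' i l j) * W i j).
  rewrite -weighted_germ mulr_suml -big_split; apply: eq_bigr => l _ /=.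
  by rewrite mulrDr mulrA.
rewrite !weighted.
have {}h1 : \sum_j (\sum_l p l * Cd l j) * z j
    - \sum_j (\sum_l y l * Cp l j) * z j + \sum_j c j * z j = 0.
  by rewrite -sumrB -big_split big1 // => j _ /=; rewrite -mulrBl -mulrDl h1 mul0r.
have {}h2 : \sum_i \sum_j (\sum_l p l * Cd' i l j) * W i j
    - \sum_i \sum_j (\sum_l y l * Cp' i l j) * W i j
    + \sum_i \sum_j (\sum_l (Cd l j * - Cp l i + Cd l i * - Cp l j)) * W i j
    + \sum_i \sum_j c' i j * W i j = 0.
  rewrite -sumrB -!big_split big1 // => i _ /=.
  rewrite -sumrB -!big_split big1 // => j _ /=.
  rewrite -mulrBl -!mulrDl.
  have -> : \sum_l (Cd l j * - Cp l i + Cd l i * - Cp l j) =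
      - \sum_l (Cd l j * Cp l i + Cd l i * Cp l j).
    by rewrite -sumrN; apply: eq_bigr => l _; ring.
  by rewrite h2 mul0r.
set a1 := \sum_j _ * z j in h1 *; set a2 := \sum_j _ * z j in h1 *.
set a3 := \sum_j c j * z j in h1 *.
set e1 := \sum_i \sum_j _ in h2 *; set e2 := \sum_i \sum_j _ in h2 *.
set e3 := \sum_i \sum_j _ in h2 *; set e4 := \sum_i \sum_j _ in h2 *.
set d1 := \sum_l p l * bd l in h0 *; set d2 := \sum_l y l * bp l in h0 *.
rewrite [LHS](_ : _ = (d1 - d2 + psi) * tau + (a1 - a2 + a3) + (e1 - e2 + e3 + e4));
  last by ring.
by rewrite h0 h1 h2 mul0r !addr0.
Qed.

End duality.

(** * Local expansions of solutions *)

Section expansions.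
Context {R : realType} {K : nat} {alpha t0 t1 : R} {Z : rough_path R K}.
Hypothesis alpha_bounds : 3^-1 < alpha <= 2^-1.
Hypothesis hZ : geometric_rough_path alpha t0 t1 Z.

Let alpha_gt0 : 0 < alpha.
Proof. by case/andP: alpha_bounds => h _; apply: lt_trans h; rewrite invr_gt0. Qed.

Let alpha3_ge0 : 0 <= 3 * alpha. Proof. by rewrite mulr_ge0 ?ltW. Qed.

Let alpha3_le : 3 * alpha <= 1 + alpha.
Proof. by case/andP: alpha_bounds => _ h; have := h; lra. Qed.

(** As the integrals over adjacent intervals add up, an equation anchored at
    either end of [[t0, t1]] gives the increments over all subintervals. The
    error of the drift is of order [1 + alpha], and [3 * alpha <= 1 + alpha]. *)
Lemma solution_expansion m (x b : R -> 'cV[R]_m) (C : R -> 'M[R]_(m, K)) C' :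
  (forall l, holder alpha t0 t1 (fun t => b t l 0)) ->
  controlled alpha t0 t1 Z C C' ->
  (forall t, t0 <= t <= t1 -> x t - x t0 = drift_int b t0 t + rough_int Z C C' t0 t)
  \/ (forall t, t0 <= t <= t1 -> x t1 - x t = drift_int b t t1 + rough_int Z C C' t t1) ->
  forall l, holder2 (3 * alpha) t0 t1 (fun s t =>
    x t l 0 - x s l 0 - (b s l 0 * (t - s) + rough_germ Z C C' s t l)).
Proof.
move=> hb hC hx l; have [alpha_gt _] := andP alpha_bounds.
have [h [hh hE]] := rough_int_expansion alpha_gt hZ hC.
have chasles s u t : t0 <= s -> s <= u -> u <= t -> t <= t1 ->
    drift_int b s t + rough_int Z C C' s t =
    (drift_int b s u + rough_int Z C C' s u) + (drift_int b u t + rough_int Z C C' u t).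
  move=> t0s su ut tt1; rewrite addrACA; congr (_ + _).
    apply/matrixP => i j; rewrite !mxE.
    exact: (Rintegral_itv_chasles alpha_gt0 (hb i)).
  have st := le_trans su ut; have t0u := le_trans t0s su; have ut1 := le_trans ut tt1.
  rewrite !hE//.
  by rewrite [RHS]addrC addrA subrK.
have xE s t : t0 <= s -> s <= t -> t <= t1 ->
    x t - x s = drift_int b s t + rough_int Z C C' s t.
  move=> t0s st tt1; have t0t := le_trans t0s st; have st1 := le_trans st tt1.
  case: hx => hx.
    have := chasles t0 s t (lexx _) t0s st tt1.
    have <- := hx t; last by rewrite t0t.
    have <- := hx s; last by rewrite t0s.
    move=> E; rewrite -[RHS](addKr (x s - x t0)) -E opprB.
    by rewrite [RHS]addrC addrA subrK.
  have := chasles s t t1 t0s st tt1 (lexx _).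
  have <- := hx s; last by rewrite t0s.
  have <- := hx t; last by rewrite t0t.
  move=> E; rewrite -[RHS](addrK (x t1 - x t)) -E opprB.
  by rewrite [RHS]addrC addrA subrK.
have hd := holder2W alpha3_ge0 alpha3_le (holder2_Rintegral alpha_gt0 (hb l)).
apply: holder2_eq (holder2D hd (hh l)) => s t t0s st tt1.
have := congr1 (fun M : 'cV_m => M l 0) (xE s t t0s st tt1).
rewrite hE// !mxE => ->; ring.
Qed.

End expansions.

(** * The coefficients of the system *)

Section affine_mx.
Context {R : realType} {n K : nat} {alpha t0 t1 : R} {Z : rough_path R K}.
Hypothesis alpha_ge0 : 0 <= alpha.

Lemma smooth_cst (c : R) : smooth (fun _ : 'cV[R]_n => c).
Proof.
move=> vs x; suff [d ->] :
    exists d, foldr (fun v (G : 'cV[R]_n -> R) => 'D_v G) (fun=> c) vs = fun=> d.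
  exact: differentiable_cst.
elim: vs => [|v vs [d /= ->]]; first by exists c.
by exists 0; apply/funext => y; exact: derive_cst.
Qed.

Lemma derive_affine_mx_entry (m k : nat) (G : 'cV[R]_n * 'cV[R]_n -> 'M[R]_(m, k))
    (a : 'I_m -> 'I_k -> 'I_n -> 'cV[R]_n -> R) (b : 'I_m -> 'I_k -> 'cV[R]_n -> R)
    (q y : R -> 'cV[R]_n) (q' y' : R -> 'I_K -> 'cV[R]_n) t i l j :
  (forall l j x, G x l j = affine_form (a l j) (b l j) x) ->
  (forall l j i, smooth (a l j i)) -> (forall l j, smooth (b l j)) ->
  comp_gub G (pair_path q y) (pair_gub q' y') t i l j =
  comp_gub (affine_form (a l j) (b l j)) (pair_path q y) (pair_gub q' y') t i.
Proof.
move=> GE sa sb.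
have GE' c d : (fun x => G x c d) = affine_form (a c d) (b c d).
  by apply/funext => x; exact: GE.
rewrite /comp_gub derive_mx ?mxE ?GE'//; apply/derivable_mxP => c d.
rewrite GE'; apply: ex_derive; apply: is_derive_affine_form => [e|];
  exact: smooth_differentiable.
Qed.

Lemma derive_affine_mx (m k : nat) (G : 'cV[R]_n * 'cV[R]_n -> 'M[R]_(m, k))
    (a : 'I_m -> 'I_k -> 'I_n -> 'cV[R]_n -> R) (b : 'I_m -> 'I_k -> 'cV[R]_n -> R) :
  (forall l j x, G x l j = affine_form (a l j) (b l j) x) ->
  (forall l j i, smooth (a l j i)) -> (forall l j, smooth (b l j)) ->
  forall (q y : R -> 'cV[R]_n) (q' y' : R -> 'I_K -> 'cV[R]_n) t i l j,
  comp_gub G (pair_path q y) (pair_gub q' y') t i l j =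
    \sum_c (comp_gub (a l j c) q q' t i * y t c 0 + a l j c (q t) * y' t i c 0)
    + comp_gub (b l j) q q' t i.
Proof.
move=> GE sa sb q y q' y' t i l j; rewrite (derive_affine_mx_entry _ _ _ _ _ _ _ _ GE sa sb).
have D := @is_derive_affine_form R n (a l j) (b l j) (q t) (y t) (q' t i) (y' t i)
  (fun c => smooth_differentiable _ (sa l j c)) (smooth_differentiable _ (sb l j)).
by rewrite /comp_gub /pair_path /pair_gub derive_val.
Qed.

Lemma controlled_affine_mx (m k : nat) (G : 'cV[R]_n * 'cV[R]_n -> 'M[R]_(m, k))
    (a : 'I_m -> 'I_k -> 'I_n -> 'cV[R]_n -> R) (b : 'I_m -> 'I_k -> 'cV[R]_n -> R)
    (q y : R -> 'cV[R]_n) (q' y' : R -> 'I_K -> 'cV[R]_n) :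
  (forall l j x, G x l j = affine_form (a l j) (b l j) x) ->
  (forall l j i, smooth (a l j i)) -> (forall l j, smooth (b l j)) ->
  controlled alpha t0 t1 Z q q' -> controlled alpha t0 t1 Z y y' ->
  controlled alpha t0 t1 Z (fun t => G (q t, y t))
    (comp_gub G (pair_path q y) (pair_gub q' y')).
Proof.
move=> GE sa sb hq hy; apply: controlled_mx => // l j.
have -> : (fun t i => comp_gub G (pair_path q y) (pair_gub q' y') t i l j) =
    comp_gub (affine_form (a l j) (b l j)) (pair_path q y) (pair_gub q' y').
  by apply/funext => t; apply/funext => i; exact: derive_affine_mx_entry.
under eq_fun do rewrite GE.
exact: controlled_affine_form.
Qed.

End affine_mx.

Section coefficients_affine.
Context {R : realType} {N K : nat}.
Context {f : 'cV[R]_N -> 'cV[R]_N} {sigma : 'cV[R]_N -> 'M[R]_(N, K)}.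
Context {L : 'cV[R]_N -> R} {LL : 'cV[R]_N -> 'rV[R]_K}.
Implicit Types x : 'cV[R]_N * 'cV[R]_N.

Lemma variation_driftE l x : variation_drift f x.1 x.2 l 0 =
  affine_form (fun i z => (partial i f z) l 0) (fun=> 0) x.
Proof.
by rewrite /affine_form mxE addr0; apply: eq_bigr => i _; rewrite mxE.
Qed.

Lemma costate_driftE i x : costate_drift f L x.1 x.2 i 0 =
  affine_form (fun l z => (partial i f z) l 0) (partial i L) x.
Proof.
rewrite /affine_form !mxE; congr (_ + _).
by apply: eq_bigr => l _; rewrite !mxE.
Qed.

Lemma dotp_gradientE x : dotp (gradient L x.1) x.2 =
  affine_form (fun i => partial i L) (fun=> 0) x.
Proof. by rewrite /affine_form addr0; apply: eq_bigr => i _; rewrite mxE. Qed.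

Lemma variation_diffusionE l j x : variation_diffusion sigma x.1 x.2 l j =
  affine_form (fun i z => (partial i sigma z) l j) (fun=> 0) x.
Proof. by rewrite /affine_form mxE addr0. Qed.

Lemma costate_diffusionE i j x : costate_diffusion sigma LL x.1 x.2 i j =
  affine_form (fun l z => (partial i sigma z) l j) (fun z => (partial i LL z) 0 j) x.
Proof.
rewrite /affine_form mxE; congr (_ + _).
by apply: eq_bigr => l _; rewrite mulrC.
Qed.

Lemma running_cost_pairingE l j x : running_cost_pairing LL x.1 x.2 l j =
  affine_form (fun i z => (partial i LL z) 0 j) (fun=> 0) x.
Proof.
by rewrite /affine_form mxE addr0; apply: eq_bigr => i _; rewrite mxE.
Qed.

End coefficients_affine.

Definition variation_gub (R : realType) (N K : nat)
    (sigma : 'cV[R]_N -> 'M[R]_(N, K)) (q dq : R -> 'cV[R]_N) :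
    R -> 'I_K -> 'M[R]_(N, K) :=
  comp_gub (fun x => variation_diffusion sigma x.1 x.2)
    (pair_path q dq) (pair_gub (q_gub sigma q) (dq_gub sigma q dq)).

Definition costate_gub (R : realType) (N K : nat)
    (sigma : 'cV[R]_N -> 'M[R]_(N, K)) (LL : 'cV[R]_N -> 'rV[R]_K)
    (q p : R -> 'cV[R]_N) : R -> 'I_K -> 'M[R]_(N, K) :=
  comp_gub (fun x => costate_diffusion sigma LL x.1 x.2)
    (pair_path q p) (pair_gub (q_gub sigma q) (p_gub sigma LL q p)).

(** * The pairing of the costate and the variation *)

Section pairing.
Context {R : realType} {N K : nat} {alpha t0 t1 : R} {Z : rough_path R K}.
Context {f : 'cV[R]_N -> 'cV[R]_N} {sigma : 'cV[R]_N -> 'M[R]_(N, K)}.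
Context {L : 'cV[R]_N -> R} {LL : 'cV[R]_N -> 'rV[R]_K}.
Context {q p dq : R -> 'cV[R]_N}.
Hypothesis alpha_ge0 : 0 <= alpha.
Hypothesis hZ : geometric_rough_path alpha t0 t1 Z.
Hypotheses (hsigma : smooth sigma) (hLL : smooth LL).
Hypothesis cq : controlled alpha t0 t1 Z q (q_gub sigma q).
Hypothesis cp : controlled alpha t0 t1 Z p (p_gub sigma LL q p).
Hypothesis cdq : controlled alpha t0 t1 Z dq (dq_gub sigma q dq).

Let smooth_sigma i l j : smooth (fun x => (partial i sigma x) l j).
Proof. by apply: smooth_entry; exact: smooth_partial. Qed.

Let smooth_LL i j : smooth (fun x => (partial i LL x) 0 j).
Proof. by apply: smooth_entry; exact: smooth_partial. Qed.

Let smooth0 : smooth (fun _ : 'cV[R]_N => 0 : R).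
Proof. exact: smooth_cst. Qed.

Let comp_gub0 r i : comp_gub (fun _ : 'cV[R]_N => 0 : R) q (q_gub sigma q) r i = 0.
Proof. exact: derive_cst. Qed.

Local Notation Cd := (fun r => variation_diffusion sigma (q r) (dq r)).
Local Notation Cp := (fun r => costate_diffusion sigma LL (q r) (p r)).
Local Notation Cc := (fun r => running_cost_pairing LL (q r) (dq r)).

Lemma controlled_variation : controlled alpha t0 t1 Z Cd (variation_gub sigma q dq).
Proof.
exact: (controlled_affine_mx alpha_ge0 variation_diffusionE
  (fun l j i => smooth_sigma i l j) (fun _ _ => smooth0) cq cdq).
Qed.

Lemma controlled_costate : controlled alpha t0 t1 Z Cp (costate_gub sigma LL q p).
Proof.
exact: (controlled_affine_mx alpha_ge0 costate_diffusionE
  (fun i j l => smooth_sigma i l j) (fun i j => smooth_LL i j) cq cp).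
Qed.

Lemma controlled_pairing : controlled alpha t0 t1 Z Cc (pairing_gub sigma LL q dq).
Proof.
exact: (controlled_affine_mx alpha_ge0 running_cost_pairingE
  (fun _ j i => smooth_LL i j) (fun _ _ => smooth0) cq cdq).
Qed.

(** All terms in [f], [sigma] and their derivatives cancel in the expansion of
    the pairing, and the germ of the running costs remains. On the second level,
    the product of the increments of [dq] and [p] provides the terms that
    differentiate [p] and [dq]. *)
Lemma pairing_increment s t : t0 <= s -> s <= t -> t <= t1 ->
  \sum_l (p s l 0 * (variation_drift f (q s) (dq s) l 0 * (t - s)
             + rough_germ Z Cd (variation_gub sigma q dq) s t l)
           - dq s l 0 * (costate_drift f L (q s) (p s) l 0 * (t - s)
             + rough_germ Z Cp (costate_gub sigma LL q p) s t l)
           + (\sum_j rp_incr Z s t j 0 * dq_gub sigma q dq s j l 0)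
             * (\sum_i rp_incr Z s t i 0 * p_gub sigma LL q p s i l 0))
  = - (dotp (gradient L (q s)) (dq s) * (t - s)
       + rough_germ Z Cc (pairing_gub sigma LL q dq) s t 0).
Proof.
move=> t0s st tt1; have [_ _ _ geoZ] := hZ.
have VD' := derive_affine_mx variation_diffusionE
  (fun l j i => smooth_sigma i l j) (fun _ _ => smooth0)
  q dq (q_gub sigma q) (dq_gub sigma q dq).
have CD' := derive_affine_mx costate_diffusionE
  (fun i j l => smooth_sigma i l j) (fun i j => smooth_LL i j)
  q p (q_gub sigma q) (p_gub sigma LL q p).
have RC' := derive_affine_mx running_cost_pairingE
  (fun (_ : 'I_1) j i => smooth_LL i j) (fun _ _ => smooth0)
  q dq (q_gub sigma q) (dq_gub sigma q dq).
have dqE i l : dq_gub sigma q dq s i l 0 = Cd s l i by rewrite mxE.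
have pE i l : p_gub sigma LL q p s i l 0 = - Cp s l i.
  by rewrite [LHS]mxE [col _ _ _ _]mxE.
have sum_dq l : \sum_j rp_incr Z s t j 0 * dq_gub sigma q dq s j l 0 =
  \sum_j rp_incr Z s t j 0 * Cd s l j by apply: eq_bigr => j _; rewrite dqE.
have sum_p l : \sum_j rp_incr Z s t j 0 * p_gub sigma LL q p s j l 0 =
  \sum_j rp_incr Z s t j 0 * - Cp s l j by apply: eq_bigr => j _; rewrite pE.
under eq_bigr do rewrite sum_dq sum_p.
apply/eqP; rewrite -addr_eq0 addrA; apply/eqP; apply: pairing_germ.
- move=> i j; have := congr1 (fun M : 'M[R]_(K, K) => M i j) (geoZ _ _ t0s st tt1).
  by rewrite !mxE big_ord1 !mxE.
- apply: etrans (duality_drift (jac f (q s)) (fun i => gradient L (q s) i 0)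
    (fun l => p s l 0) (fun l => dq s l 0)).
  congr (_ - _ + _); apply: eq_bigr => l _; rewrite !mxE //.
  by congr (_ * (_ + _)); apply: eq_bigr => m _; rewrite !mxE.
- move=> j; apply: etrans (duality_drift
    (fun l i => (partial i sigma (q s)) l j) (fun i => (partial i LL (q s)) 0 j)
    (fun l => p s l 0) (fun l => dq s l 0)).
  congr (_ - _ + _).
  + by apply: eq_bigr => l _; rewrite !mxE.
  + apply: eq_bigr => l _; rewrite !mxE; congr (_ * (_ + _)).
    by apply: eq_bigr => m _; rewrite mulrC.
  + by rewrite mxE; apply: eq_bigr => l _; rewrite !mxE.
- move=> i j; apply: etrans (duality_second_level
    (fun a l => (partial a sigma (q s)) l j)
    (fun a l => comp_gub (fun z => (partial a sigma z) l j) q (q_gub sigma q) s i)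
    (fun a => (partial a LL (q s)) 0 j)
    (fun a => comp_gub (fun z => (partial a LL z) 0 j) q (q_gub sigma q) s i)
    (fun l => p s l 0) (fun l => dq s l 0) (fun l => Cd s l i) (fun l => Cp s l i)).
  congr (_ - _ - _ + _).
  + apply: eq_bigr => l _; rewrite [variation_gub _ _ _ _ _ _ _]VD' comp_gub0 addr0.
    by congr (_ * _); apply: eq_bigr => a _; rewrite dqE.
  + apply: eq_bigr => l _; rewrite [costate_gub _ _ _ _ _ _ _ _]CD'; congr (_ * (_ + _)).
    by apply: eq_bigr => m _; rewrite pE.
  + apply: eq_bigr => l _.
    rewrite [variation_diffusion _ _ _ l j]mxE [costate_diffusion _ _ _ _ l j]mxE.
    by congr (_ * _ + _ * (_ + _)).
  + rewrite [pairing_gub _ _ _ _ _ _ _ _]RC' comp_gub0 addr0.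
    by apply: eq_bigr => a _; rewrite dqE.
Qed.

End pairing.

Theorem proposition2p8 (R : realType) (N K : nat) (alpha t0 t1 : R)
    (Z : rough_path R K)
    (f : 'cV[R]_N -> 'cV[R]_N) (sigma : 'cV[R]_N -> 'M[R]_(N, K))
    (L : 'cV[R]_N -> R) (LL : 'cV[R]_N -> 'rV[R]_K)
    (q p dq : R -> 'cV[R]_N) (da : 'cV[R]_N)
    (halpha : 3^-1 < alpha <= 2^-1)
    (ht : t0 <= t1)
    (hZ : geometric_rough_path alpha t0 t1 Z)
    (hf : smooth f) (hsigma : smooth sigma) (hL : smooth L) (hLL : smooth LL)
    (hqp : adjoint_solution alpha t0 t1 Z f sigma L LL q p)
    (hdq : variational_solution alpha t0 t1 Z f sigma q da dq) :
  rough_integrable alpha t0 t1 Z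
    (fun r => running_cost_pairing LL (q r) (dq r))
    (pairing_gub sigma LL q dq) /\
  dotp (p t1) (dq t1) - dotp (p t0) (dq t0) =
    - (\int[lebesgue_measure]_(r in `[t0, t1]) dotp (gradient L (q r)) (dq r)
       + rough_int Z
           (fun r => running_cost_pairing LL (q r) (dq r))
           (pairing_gub sigma LL q dq) t0 t1 0 0).
Proof.
have [alpha_gt alpha_le] := andP halpha.
have alpha_gt0 : 0 < alpha by apply: lt_trans alpha_gt; rewrite invr_gt0.
have alpha_ge0 := ltW alpha_gt0.
have a3 : 0 <= 3 * alpha by rewrite mulr_ge0.
have a3_le : 3 * alpha <= 1 + alpha by lra.
case: hqp => cq cp _ eqp; case: hdq => cdq _ eqdq.
have sf i l : smooth (fun x => (partial i f x) l 0).
  by apply: smooth_entry; exact: smooth_partial.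
have s0 : smooth (fun _ : 'cV[R]_N => 0 : R) by exact: smooth_cst.
have hbd l : holder alpha t0 t1 (fun r => variation_drift f (q r) (dq r) l 0).
  have [+ _ _] := controlled_affine_form alpha_ge0 (fun i => sf i l) s0 cq cdq.
  by apply: holder2_eq => s t _ _ _; rewrite -!variation_driftE.
have hbp i : holder alpha t0 t1 (fun r => costate_drift f L (q r) (p r) i 0).
  have [+ _ _] := controlled_affine_form alpha_ge0 (sf i) (smooth_partial i hL) cq cp.
  by apply: holder2_eq => s t _ _ _; rewrite -!costate_driftE.
pose psi r := dotp (gradient L (q r)) (dq r).
have hpsi : holder alpha t0 t1 psi.
  have [+ _ _] := controlled_affine_form alpha_ge0 (fun i => smooth_partial i hL) s0 cq cdq.
  by apply: holder2_eq => s t _ _ _; rewrite -!dotp_gradientE.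
have cVD := controlled_variation alpha_ge0 hsigma cq cdq.
have cCD := controlled_costate alpha_ge0 hsigma hLL cq cp.
have Edq := solution_expansion halpha hZ hbd cVD (or_introl eqdq).
(* The sign of the backward equation of p is absorbed into - p. *)
have Ep l : holder2 (3 * alpha) t0 t1 (fun s t => - (p t l 0 - p s l 0)
    - (costate_drift f L (q s) (p s) l 0 * (t - s) + rough_germ Z
        (fun r => costate_diffusion sigma LL (q r) (p r))
        (costate_gub sigma LL q p) s t l)).
  have eqNp t : t0 <= t <= t1 -> - p t1 - - p t =
      drift_int (fun r => costate_drift f L (q r) (p r)) t t1
      + rough_int Z (fun r => costate_diffusion sigma LL (q r) (p r))
          (costate_gub sigma LL q p) t t1.
    by move=> tt; rewrite -opprD eqp// opprK.
  have := @solution_expansion R K alpha t0 t1 Z halpha hZ N (fun t => - p t) _ _ _ hbp cCD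
    (or_intror eqNp) l.
  by apply: holder2_eq => s t _ _ _; congr (_ - _);
    rewrite [X in _ = X + _]mxE [X in _ = _ - X]mxE opprD.
have cross l := controlled_increment_product alpha_ge0
  (controlled_entry l 0 cdq) (controlled_entry l 0 cp).
have bounded (Y : R -> 'cV[R]_N) Y' l : controlled alpha t0 t1 Z Y Y' ->
    holder2 0 t0 t1 (fun s _ => Y s l 0).
  by move=> /(controlled_entry l 0)[hY _ _]; exact: holder_bounded hY.
(* h is, up to a constant, the integral of the running cost against dZ that the
   conservation law predicts. *)
pose h t := - (dotp (p t) (dq t) + \int[lebesgue_measure]_(r in `[t0, t]) psi r).
have hh l : holder2 (3 * alpha) t0 t1 (fun s t => (\col_(_ < 1) h t) l 0
    - (\col_(_ < 1) h s) l 0 - rough_germ Z (fun r => running_cost_pairing LL (q r) (dq r))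
      (pairing_gub sigma LL q dq) s t l).
  have k1 := holder2W a3 a3_le (holder2_Rintegral alpha_gt0 hpsi).
  have k2 := holder2_sum cross.
  have k3 := holder2_sum (fun l => holder2M (lexx 0) a3 (bounded _ _ l cp) (Edq l)).
  have k4 := holder2_sum (fun l => holder2M (lexx 0) a3 (bounded _ _ l cdq) (Ep l)).
  rewrite add0r in k3 k4.
  apply: holder2_eq (holder2B (holder2B (holder2B k4 k3) k2) k1) => s t t0s st tt1.
  have E := pairing_increment (f := f) (L := L) (p := p) (dq := dq) hZ hsigma hLL t0s st tt1.
  have := dotp_increment (fun l => p s l 0) (fun l => p t l 0)
    (fun l => dq s l 0) (fun l => dq t l 0)
    (fun l => variation_drift f (q s) (dq s) l 0 * (t - s) + rough_germ Z
      (fun r => variation_diffusion sigma (q r) (dq r)) (variation_gub sigma q dq) s t l)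
    (fun l => costate_drift f L (q s) (p s) l 0 * (t - s) + rough_germ Z
      (fun r => costate_diffusion sigma LL (q r) (p r)) (costate_gub sigma LL q p) s t l)
    (fun l => (\sum_j rp_incr Z s t j 0 * dq_gub sigma q dq s j l 0)
      * (\sum_i rp_incr Z s t i 0 * p_gub sigma LL q p s i l 0)).
  rewrite /= {}E.
  rewrite !mxE ord1 /h (Rintegral_itv_chasles alpha_gt0 hpsi (lexx t0) t0s st tt1).
  have regroup gt gs s2 s3 s4 G I J w : gt - gs = s3 - s4 + s2 - (w + G) ->
      - (gt + (J + I)) - - (gs + J) - G = s4 - s3 - s2 - (I - w) :> R.
    by move=> e; transitivity (- (gt - gs) - I - G); [ring | rewrite e; ring].
  exact: regroup.
have cvI := rough_sum_cvg alpha_gt hh (lexx t0) ht (lexx t1).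
split.
  split; first exact: controlled_pairing alpha_ge0 hLL cq cdq.
  by apply/cvg_ex; eexists; exact: cvI.
rewrite (rough_int_eq alpha_gt hh (lexx t0) ht (lexx t1)) !mxE /h.
by rewrite set_itv1 Rintegral_set1 addr0 /psi; ring.
Qed.
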